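(* Let $F$ be a field of characteristic $2$, let $p$ and $q$ be anisotropic quasilinear quadratic forms of dimension $\geq 2$ over $F$, let $s$ be the unique non-negative integer such that $2^s < \dim(p) \leq 2^{s+1}$, and let $k = \dim(q) - 2\,\mathfrak{i}_0(q_{F(p)})$. If $k \leq 2^{s-1}$, then $$\dim(q) = a 2^{\mathrm{lndeg}(p)} + \epsilon$$ for some non-negative integer $a$ and some integer $\epsilon$ with $-k \leq \epsilon \leq k$. In particular, if $k \leq 2^{s-1}$, then $\dim(q) = a' 2^{s+1} + \epsilon'$ for some non-negative integer $a'$ and some integer $\epsilon'$ with $-k\leq \epsilon'\leq k$.
   Context: All quadratic forms are finite-dimensional. A quadratic form over a field of characteristic $2$ is quasilinear if it is isometric to $\langle a_0,\ldots,a_n\rangle := a_0x_0^2+\cdots+a_nx_n^2$ for some scalars $a_i$. For a quasilinear form $\varphi$, the isotropic vectors (vectors $v$ with $\varphi(v)=0$) form a linear subspace, and the isotropy index $\mathfrak{i}_0(\varphi)$ is its dimension; $\varphi$ is anisotropic if $\mathfrak{i}_0(\varphi)=0$. For a field extension $L/F$, $\varphi_L$ is the scalar extension of $\varphi$ to $L$. For an anisotropic form $p$ of dimension $\geq 2$, $F(p)$ is the function field of the integral projective $F$-quadric $\{p=0\}$. For a non-zero form $\varphi$ with set of represented values $D(\varphi)=\{\varphi(v)\}$, the norm field $N(\varphi)$ is the smallest subfield of $F$ containing $\{ab \mid a,b\in D(\varphi)\}$; if $\varphi\simeq\langle a_0,\ldots,a_n\rangle$ with $a_0\neq 0$, then $N(\varphi)=F^2(a_0a_1,\ldots,a_0a_n)$.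 It is a finite extension of $F^2$ of degree a power of $2$, and $\mathrm{lndeg}(\varphi):=\log_2[N(\varphi):F^2]$. *)

(* Defs.v *)
From HB Require Import structures.
From mathcomp Require Import all_boot all_order all_algebra.
From mathcomp Require Import boolp classical_sets.
From mathcomp Require Import mpoly.

Set Implicit Arguments.
Unset Strict Implicit.
Unset Printing Implicit Defensive.

Import Order.TTheory GRing.Theory Num.Theory.

Local Open Scope classical_set_scope.
Local Open Scope ring_scope.

(* A quadratic form of dimension n over F is a form q on F^n, given by a
   polynomial [q : {mpoly F[n]}] that is homogeneous of degree 2.  Its scalar
   extension along [iota : {rmorphism F -> L}] is [map_mpoly iota q]. *)

Section QuadraticForms.
Variables (F : fieldType) (n : nat).
Implicit Types (p q : {mpoly F[n]}) (v : 'rV[F]_n).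

Definition quadratic_form q : Prop := q \is 2.-homog.

Definition qval q v : F := q.@[v ord0].

Definition isometric p q : Prop :=
  exists2 P : 'M[F]_n, P \in unitmx & forall v, qval p (v *m P) = qval q v.

Definition diag_form (a : 'I_n -> F) : {mpoly F[n]} :=
  \sum_(i < n) a i *: 'X_i ^+ 2.

Definition quasilinear q : Prop :=
  quadratic_form q /\ exists a : 'I_n -> F, isometric q (diag_form a).

(* When q is quasilinear in characteristic 2, exactly one subspace satisfies
   the condition; the default 0 is only reached for other q. *)
Definition isotropic_space q : {vspace 'rV[F]_n} :=
  xget 0%VS [set U : {vspace 'rV[F]_n} | forall v, v \in U <-> qval q v = 0].

Definition isotropy_index q : nat := \dim (isotropic_space q).

Definition anisotropic q : Prop := isotropy_index q = 0%N.

Definition values q : set F := range (qval q).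

End QuadraticForms.

Section NormField.
Variable F : fieldType.

Definition subfield_set (K : set F) : Prop :=
  [/\ K 1, forall x y, K x -> K y -> K (x - y)
    & forall x y, K x -> K y -> K (x / y)].

Definition squares : set F := range (fun x : F => x ^+ 2).

Definition ext_basis (K E : set F) d (b : 'I_d -> F) : Prop :=
  (forall i, E (b i)) /\
  forall x, E x -> exists! c : {ffun 'I_d -> F},
    (forall i, K (c i)) /\ x = \sum_(i < d) c i * b i.

(* The degree [E : K] of subfields K of E of F, when it is finite; 0 otherwise. *)
Definition ext_degree (K E : set F) : nat :=
  xget 0%N [set d | exists b : 'I_d -> F, ext_basis K E b].

Definition norm_field n (q : {mpoly F[n]}) : set F :=
  smallest subfield_set [set a * b | a in values q & b in values q].

(* [norm_field q] has 2-power degree over [squares] for nonzero quasilinear q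
   in characteristic 2, so that [trunc_log] is then the exact logarithm. *)
Definition lndeg n (q : {mpoly F[n]}) : nat :=
  trunc_log 2 (ext_degree squares (norm_field q)).

End NormField.

(* [iota : F -> L] is, up to F-isomorphism, the function field of the integral
   projective quadric Proj S, where S = F[x_0, .., x_(n-1)] / (p): a field K
   containing S (through [e], of kernel (p)) is given, in which L is the field
   of all fractions f / g with f, g in S homogeneous of the same degree and
   g nonzero. *)
Definition is_function_field (F : fieldType) n (p : {mpoly F[n]})
    (L : fieldType) (iota : {rmorphism F -> L}) : Prop :=
  exists (K : fieldType) (j : {rmorphism L -> K})
         (e : {rmorphism {mpoly F[n]} -> K}),
  [/\ forall f, e f = 0 <-> exists g, f = g * p,
      forall c, e c%:MP = j (iota c)
    & forall z, (exists y, z = j y) <->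
        exists d (f g : {mpoly F[n]}),
          [/\ f \is d.-homog, g \is d.-homog, e g != 0 & z = e f / e g]].

(* Main.v *)
(* Let [B = F^2].  The values of [q] form a [B]-subspace [V] of [F] of dimension
   [n], and those of [p], divided by one of them, span [U] with [1 \in U]; the
   norm field is [N = B(U)].  Specializing isotropic vectors over [F(p)] to
   points of the quadric [p = 0] over [F(sqrt u)] gives
   [\dim (V + u V) <= n + k] for generic [u \in U].  If [u] moreover maximizes
   [\dim (V + u V) + \dim (U + u U)], then moving [u] along lines shows that
   [U (V :&: u V) <= V + u V] and [U (U :&: u U) <= U + u U].  The second
   inclusion makes [U' = U + u U] a module over the field [B(U :&: u U)], and
   since all degrees are powers of 2 this forces [\dim U' >= 2^(s+1)].  Now
   [U' Z <= V + u V] with [Z = V :&: u V], where the dimensions of [Z] and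
   [V + u V] differ by at most [2 k <= 2^s]; by the linear Olson inequality
   [3 (\dim (U' Z) - \dim Z) >= 2 \dim U'] unless [U' Z = N Z], so [U' Z] is an
   [N]-space between [Z] and [V + u V], of dimension within [k] of [n]. *)

Require Import Defs.
From HB Require Import structures.
From mathcomp Require Import all_boot all_order all_algebra all_field.
From mathcomp Require Import boolp classical_sets.
From mathcomp Require Import mpoly.
From mathcomp Require Import zify ring.

Set Implicit Arguments.
Unset Strict Implicit.
Unset Printing Implicit Defensive.

Import Order.TTheory GRing.Theory Num.Theory.

Local Open Scope ring_scope.

(** * Orthogonal subspaces inside a subfield *)

Section Perp.
Variables (B : fieldType) (L : fieldExtType B).
Implicit Types (U V W X Y : {vspace L}) (N : {subfield L}).

(** The orthogonal is taken for the form [t (x * y)], with [t] a linear functional such that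
    [t 1 != 0]. The form is nondegenerate on [N], since a nonzero [y] pairs with [y^-1] to [t 1].
    Multiplication by [w] is self-adjoint, whence the third property. *)
Lemma exists_perp N : exists perp : {vspace L} -> {vspace L},
  [/\ forall X, (perp X <= N)%VS,
      forall X, (X <= N)%VS -> (\dim (perp X) + \dim X = \dim N)%N &
      forall W X Y, (W <= N)%VS -> (W * X <= Y)%VS -> (W * perp Y <= perp X)%VS].
Proof.
pose e := vbasis {:L}.
have [i0 i0P] : exists i0, coord e i0 (1 : L) != 0.
  apply/existsP; apply: contraT; rewrite negb_exists => /forallP h.
  have := oner_neq0 L; rewrite (coord_vbasis (memvf (1 : L))) big1 ?eqxx // => i _.
  by have := h i; rewrite negbK => /eqP ->; rewrite scale0r.
pose t (y : L) : B := coord e i0 y.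
have tD a x y : t (a *: x + y) = a * t x + t y by rewrite /t linearP.
pose Phi X (y : L) : 'rV[B]_(\dim X) := \row_i t (y * (vbasis X)`_i).
have Phi_lin X : linear (Phi X).
  by move=> a x y; apply/rowP=> i; rewrite !mxE mulrDl -scalerAl tD.
pose PhiL X : {linear L -> 'rV[B]_(\dim X)} :=
  HB.pack (Phi X) (GRing.isLinear.Build _ _ _ _ (Phi X) (Phi_lin X)).
pose PhiH X := linfun (PhiL X).
have PhiE X y : PhiH X y = Phi X y by rewrite lfunE.
pose perp X := (N :&: lker (PhiH X))%VS.
have t0 : t 0 = 0 by rewrite /t linear0.
have perpP X y : reflect (y \in N /\ forall x, x \in X -> t (y * x) = 0) (y \in perp X).
  rewrite memv_cap memv_ker PhiE; apply: (iffP andP) => -[yN].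
    move=> /eqP/rowP y0; split=> // x /coord_vbasis ->.
    rewrite mulr_sumr; elim/big_rec: _ => // i z _ z0.
    by rewrite -scalerAr tD z0; have := y0 i; rewrite !mxE => ->; rewrite mulr0 addr0.
  move=> h; split=> //; apply/eqP/rowP => i; rewrite !mxE; apply: h.
  by apply: vbasis_mem; rewrite mem_nth // size_tuple.
have perp_ge X : (\dim N <= \dim (perp X) + \dim X)%N.
  rewrite -(limg_ker_dim (PhiH X) N) leq_add2l.
  by rewrite (leq_trans (dimvS (subvf _))) // dimvf /dim /= mul1n.
have perpN : perp N = 0%VS.
  apply/eqP; rewrite -subv0; apply/subvP => y /perpP[yN h]; rewrite memv0.
  apply: contraT => yNZ; case/negP: i0P; apply/eqP.
  by have := h _ (etrans (memvV N y) yN); rewrite divff.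
exists perp; split=> [X|X XN|W X Y WN WXY].
- exact: capvSl.
- apply/eqP; rewrite eqn_leq perp_ge andbT.
  have dX : (\dim X + \dim (N :\: X)%VS = \dim N)%N.
    by rewrite -(dimv_cap_compl N X) (capv_idPr XN).
  (* For the bound opposite to [perp_ge]: the orthogonals of [X] and of a complement meet in
     [perp N = 0], so their dimensions add up to at most [\dim N]. *)
  have : (perp X :&: perp (N :\: X) <= perp N)%VS.
    apply/subvP => y; rewrite memv_cap => /andP[/perpP[yN h1] /perpP[_ h2]].
    apply/perpP; split=> // x; rewrite -(addv_diff_cap N X) (capv_idPr XN).
    case/memv_addP => x1 x1P [x2 x2P ->]; rewrite mulrDr -[_ * x1]scale1r tD.
    by rewrite h1 // h2 // mulr0 addr0.
  rewrite perpN subv0 => /eqP cap0.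
  have : (\dim (perp X + perp (N :\: X))%VS <= \dim N)%N.
    by apply: dimvS; rewrite subv_add !capvSl.
  rewrite dimv_disjoint_sum // => h.
  have arith a b c d n : (a + b <= n -> n <= b + c -> d + c = n -> a + d <= n)%N by clear; lia.
  exact: arith h (perp_ge _) dX.
- apply/prodvP => w y wW /perpP[yN h]; apply/perpP; split.
    by rewrite memvM // (subvP WN).
  by move=> x xX; rewrite -mulrA mulrCA h // (subvP WXY) // memv_mul.
Qed.
End Perp.

(** * The linear Olson inequality *)

Section Olson.
Variables (B : fieldType) (L : fieldExtType B).
Implicit Types (X Y : {vspace L}).

Lemma prodv_lineK X (c : L) : c != 0 -> (X * <[c]> * <[c^-1]>)%VS = X.
Proof. by move=> cNZ; rewrite -prodvA prodv_line divff // prodv1. Qed.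

Lemma memv_prod_line X (c x : L) : x \in X -> x * c \in (X * <[c]>)%VS.
Proof. by move=> xX; rewrite memv_mul ?memv_line. Qed.

Lemma adjoin_degree_sqrt (E : {subfield L}) x :
  x ^+ 2 \in 1%VS -> x \notin E -> adjoin_degree E x = 2%N.
Proof.
move=> /vlineP[b xb] xE; apply/eqP; rewrite eqn_leq; apply/andP; split; last first.
  by rewrite ltn_neqAle eq_sym adjoin_deg_eq1 xE.
rewrite -ltnS -size_minPoly.
have /minPoly_dvdp : ('X^2 - b%:A%:P : {poly L}) \is a polyOver E.
  by rewrite rpredB ?rpredX ?polyOverX // polyOverC rpredZ ?mem1v.
move=> /(_ x); rewrite rootE !hornerE xb subrr => /(_ (eqxx _)) /dvdp_leq.
rewrite size_XnsubC // => -> //.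
by rewrite -size_poly_eq0 size_XnsubC.
Qed.

(** Starting from the scalars, elements of [K] are adjoined one at a time; their squares are
    scalars, so each new one doubles the degree. The induction is on a bound for the missing
    dimension. *)
Lemma dim_subfield_pow2 (K : {subfield L}) :
  (forall x : L, x ^+ 2 \in 1%VS) -> exists r, \dim K = (2 ^ r)%N.
Proof.
move=> sq; suff main d : forall E : {subfield L}, (E <= K)%VS ->
    (\dim K - \dim E <= d)%N -> (exists r, \dim E = (2 ^ r)%N) ->
    exists r, \dim K = (2 ^ r)%N.
  by apply: (main _ _ (sub1v K) (leqnn _)); exists 0%N; rewrite dimv1.
elim: d => [|d IHd] E EK dE [r Er].
  exists r; apply/eqP; rewrite eqn_leq -{1}Er -subn_eq0 -leqn0 dE.
  by rewrite -Er dimvS.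
have [KE|/subvPn[x xK xE]] := boolP (K <= E)%VS.
  by exists r; rewrite -Er; congr (\dim _); apply/eqP; rewrite eqEsubv KE.
have dEx : \dim <<E; x>>%AS = (2 ^ r.+1)%N.
  by rewrite [LHS]dim_Fadjoin adjoin_degree_sqrt // Er expnS.
apply: (IHd <<E; x>>%AS); last by exists r.+1.
  by apply/FadjoinP.
rewrite dEx expnS -Er -ltnS (leq_trans _ dE) // ltn_sub2l //.
  rewrite (ltn_leqif (dimv_leqif_sup EK)); apply/negP => KE.
  by rewrite (subvP KE) in xE.
by rewrite mul2n -addnn -[X in (X < _)%N]addn0 ltn_add2l adim_gt0.
Qed.

Variables (U : {vspace L}) (N : {subfield L}).
Hypothesis U1 : 1 \in U.

Let subUN X : (X <= U * X)%VS.
Proof. by apply/subvP => x xX; rewrite -[x]mul1r memv_mul. Qed.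

Let leqU X : (\dim X <= \dim (U * X)%VS)%N.
Proof. exact/dimvS/subUN. Qed.

(** [delta] is the quantity that the inequality bounds from below, and [P] selects the spaces for
    which it is claimed. *)
Let delta X := (\dim (U * X)%VS - \dim X)%N.
Let P X := (X != 0%VS) && ((U * X)%VS != (N * X)%VS).

Let delta_scale X (c : L) : c != 0 -> delta (X * <[c]>) = delta X.
Proof. by move=> cNZ; rewrite /delta prodvA !dim_cosetv. Qed.

Let P_scale X (c : L) : c != 0 -> P X -> P (X * <[c]>)%VS.
Proof.
move=> cNZ /andP[XNZ UX]; apply/andP; split.
  by rewrite -dimv_eq0 dim_cosetv // dimv_eq0.
rewrite !prodvA; apply: contra UX => /eqP/(congr1 (fun Z => Z * <[c^-1]>)%VS).
by rewrite !prodv_lineK // => ->.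
Qed.

(** Two successive minimizations: of [delta], then of the dimension among the minimizers. *)
Let atom X : P X -> exists A, [/\ P A, forall Y, P Y -> (delta A <= delta Y)%N
  & forall Y, P Y -> (delta Y <= delta A)%N -> (\dim A <= \dim Y)%N].
Proof.
move=> PX.
have ex1 : exists d, `[< exists2 A, P A & delta A = d >].
  by exists (delta X); apply/asboolP; exists X.
case: (ex_minnP ex1) => d /asboolP[A0 PA0 dA0] dmin.
have ex2 : exists e, `[< exists2 A, P A /\ delta A = d & \dim A = e >].
  by exists (\dim A0); apply/asboolP; exists A0.
case: (ex_minnP ex2) => e /asboolP[A [PA dA] eA] emin.
have dle Y : P Y -> (d <= delta Y)%N.
  by move=> PY; apply: dmin; apply/asboolP; exists Y.
exists A; rewrite dA eA; split=> // Y PY Yd.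
apply: emin; apply/asboolP; exists Y => //; split=> //.
by apply/eqP; rewrite eqn_leq Yd dle.
Qed.

Hypothesis UN : (U <= N)%VS.
Hypothesis Ngen : forall M : {subfield L}, (U <= M)%VS -> (N <= M)%VS.
Hypothesis sq : forall x : L, x ^+ 2 \in 1%VS.

Let UX_N X : (X <= N)%VS -> (U * X <= N)%VS.
Proof. by move=> XN; apply: prodv_sub. Qed.

Let N_line X : (X <= N)%VS -> X != 0%VS -> (N * X)%VS = N.
Proof.
move=> XN XNZ; apply/eqP; rewrite eqEsubv prodv_sub //=.
apply/subvP => y yN.
have vNZ : vpick X != 0 by rewrite vpick0.
rewrite -(mulfVK vNZ y) memv_mul ?memv_pick // memvM // memvV.
exact/(subvP XN)/memv_pick.
Qed.

Let dim_cap_add X Y : (\dim (X + Y)%VS + \dim (X :&: Y)%VS = \dim X + \dim Y)%N.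
Proof. exact: dimv_sum_cap. Qed.

Let dim0 X : X != 0%VS -> (0 < \dim X)%N.
Proof. by rewrite lt0n dimv_eq0. Qed.

(* Hamidoune's argument: a normalized minimizer [A] of the excess [delta] lies in
   [N], is fixed by multiplication by each of its nonzero elements, hence is a
   subfield over which [U * A] has degree at least 3. *)
Let atom_excess A : P A -> 1 \in A -> ~~ (N <= A)%VS ->
  (forall Y, P Y -> (delta A <= delta Y)%N) ->
  (forall Y, P Y -> (delta Y <= delta A)%N -> (\dim A <= \dim Y)%N) ->
  (2 * \dim U <= 3 * delta A)%N.
Proof.
move=> /andP[ANZ UA] A1 NA Amin Amin'.
(* If [U * (A :&: N) = N], then [U * (A + N) = U * A], and minimality of the excess forces [N <= A].
   Otherwise [A :&: N] is a competitor of no larger excess, and minimality of the dimension gives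
   [A :&: N = A]. *)
have AN : (A <= N)%VS.
  have capN1 : 1 \in (A :&: N)%VS by rewrite memv_cap A1 mem1v.
  have capNZ : (A :&: N)%VS != 0%VS.
    by apply: contraTneq capN1 => ->; rewrite memv0 oner_eq0.
  have NcapN : (N * (A :&: N))%VS = N by rewrite N_line ?capvSr.
  have Ucap : (U * (A :&: N) <= U * A :&: N)%VS.
    by rewrite subv_cap prodvSr ?capvSl //= UX_N ?capvSr.
  have [UcapN|UcapN] := eqVneq (U * (A :&: N))%VS N.
    have PAN : P (A + N)%VS.
      have NUA : (N <= U * A)%VS by rewrite -UcapN prodvSr ?capvSl.
      rewrite /P; apply/andP; split.
        by apply: contraNneq ANZ => AN0; rewrite -subv0 -AN0 addvSl.
      apply: contra UA => /eqP UAN.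
      have UAE : (U * (A + N) = U * A)%VS.
        apply/eqP; rewrite eqEsubv [X in _ && X]prodvSr ?addvSl // andbT prodvDr subv_add subvv /=.
        by rewrite (subv_trans _ NUA) // UX_N.
      rewrite -UAE UAN prodvDr.
      apply/eqP/eqP; rewrite eqEsubv addvSl andbT subv_add subvv /= prodv_id.
      by rewrite -{1}(N_line (sub1v N) (vspace1_neq0 _)) prodvSr.
    have : (\dim (U * (A + N))%VS <= \dim (U * A)%VS)%N.
      apply: dimvS; rewrite prodvDr subv_add subvv /=.
      by rewrite (subv_trans (UX_N (subvv _))) // -UcapN prodvSr ?capvSl.
    have := dimvS (addvSl A N); have := Amin _ PAN; have := leqU A.
    have := leqU (A + N)%VS; rewrite /delta => h1 h2 h3 h4 h5.
    have arith a ua b ub :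
      (b <= ub -> a <= ua -> ua - a <= ub - b -> a <= b -> ub <= ua -> a = b)%N by clear; lia.
    have /eqP := arith _ _ _ _ h1 h2 h3 h4 h5.
    rewrite (dimv_leqif_eq (addvSl A N)) => /eqP AE.
    by case/negP: NA; rewrite AE addvSr.
  have Pcap : P (A :&: N)%VS by rewrite /P capNZ NcapN.
  have h1 : (delta (A :&: N) <= delta A)%N.
    have h1 := dimvS Ucap; have h2 := dim_cap_add (U * A)%VS N.
    have h3 := dim_cap_add A N.
    have h4 := dimvS (addvS (subUN A) (subvv N)).
    have h5 := leqU (A :&: N)%VS; have h6 := leqU A.
    have arith x ux c s n a ua s' : (ux <= c -> s + c = ua + n -> s' + x = a + n ->
      s' <= s -> x <= ux -> a <= ua -> ux - x <= ua - a)%N by clear; lia.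
    exact: arith h1 h2 h3 h4 h5 h6.
  have := Amin' _ Pcap h1; rewrite (geq_leqif (dimv_leqif_eq (capvSl A N))).
  by move=> /eqP <-; rewrite capvSr.
have NAN : (N * A)%VS = N by rewrite N_line.
(* [perp (U * A)] is a competitor for the minimum; this bounds [\dim A]. *)
have [perp [perpN dimperp adj]] := exists_perp N.
have UAN := UX_N AN.
have UAlt : (\dim (U * A)%VS < \dim N)%N.
  by rewrite (ltn_leqif (dimv_leqif_eq UAN)) -NAN.
pose A' := perp (U * A)%VS.
have dimA' : (\dim A <= \dim A')%N.
  have A'NZ : A' != 0%VS.
    by rewrite -dimv_eq0 -lt0n -(ltn_add2r (\dim (U * A)%VS)) add0n dimperp.
  have UA' : (U * A' <= perp A)%VS by apply: adj.
  have dp := dimperp _ AN; have dA := dim0 ANZ; have dp' := dimperp _ UAN.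
  have dUA' := dimvS UA'; have A'l := leqU A'; have Al := leqU A.
  have arith a' a ua' ua n p : (p + a = n -> a' + ua = n -> ua' <= p -> a' <= ua' ->
    a <= ua -> ua' - a' <= ua - a)%N by clear; lia.
  apply: Amin'; last exact: arith dp dp' dUA' A'l Al.
  rewrite /P A'NZ /= N_line ?perpN //; apply/eqP => UA'N.
  have arith2 a n p : (p + a = n -> 0 < a -> n <= p -> False)%N by clear; lia.
  by rewrite UA'N in dUA'; exact: arith2 dp dA dUA'.
(* By submodularity [delta X + delta Y <= 2 * delta A]. If [U * Y != N], both spaces compete, so [X]
   attains the minimum and is no smaller than [A]. If [U * Y = N], the bound [\dim A <= \dim A']
   would force [X = 0], but [a] lies in [X]. *)
have stable a : a \in A -> a != 0 -> (A * <[a]>)%VS = A.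
  move=> aA aNZ; pose X := (A :&: (A * <[a]>))%VS; pose Y := (A + A * <[a]>)%VS.
  have AaN : (A * <[a]> <= N)%VS.
    by apply: prodv_sub => //; rewrite -memvE (subvP AN).
  have XNZ : X != 0%VS.
    have : a \in X by rewrite memv_cap aA -{1}[a]mul1r memv_prod_line.
    by apply: contraTneq => ->; rewrite memv0.
  have XN : (X <= N)%VS by rewrite (subv_trans (capvSl _ _)).
  have YN : (Y <= N)%VS by rewrite subv_add AN.
  have YNZ : Y != 0%VS by apply: contraNneq ANZ => Y0; rewrite -subv0 -Y0 addvSl.
  have PX : P X.
    rewrite /P XNZ N_line //; apply: contraTneq UAlt => UX; rewrite -leqNgt.
    by rewrite -UX dimvS // prodvSr // capvSl.
  have dXY := dim_cap_add A (A * <[a]>)%VS.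
  have dUXY := dim_cap_add (U * A)%VS (U * A * <[a]>)%VS.
  have UX : (\dim (U * X)%VS <= \dim (U * A :&: U * A * <[a]>)%VS)%N.
    by apply: dimvS; rewrite subv_cap -prodvA !prodvSr ?capvSl ?capvSr.
  have UY : (U * A + U * A * <[a]>)%VS = (U * Y)%VS by rewrite prodvDr prodvA.
  rewrite UY !dim_cosetv // -/X -/Y in dXY dUXY UX.
  have XA := Amin _ PX; have lA := leqU A; have lX := leqU X; have lY := leqU Y.
  have dX := dim0 XNZ.
  suff dAX : (\dim A <= \dim X)%N.
    have /eqP XA' : X == A by rewrite -(geq_leqif (dimv_leqif_eq (capvSl A _))).
    apply/esym/eqP; rewrite -(geq_leqif (dimv_leqif_eq _)) ?dim_cosetv //.
    by rewrite -{1}XA' capvSr.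
  have [UYN|UYN] := eqVneq (U * Y)%VS N.
    have := dimperp _ UAN; rewrite -/A' => dp; rewrite UYN in dUXY.
    have arith t ut x ux y n i t' : (ut - t <= ux - x -> t <= ut -> x <= ux ->
      0 < x -> y + x = t + t -> n + i = ut + ut -> ux <= i -> t' + ut = n ->
      t <= t' -> t <= x)%N by clear; lia.
    exact: arith XA lA lX dX dXY dUXY UX dp dimA'.
  have PY : P Y by rewrite /P YNZ N_line.
  have YA := Amin _ PY; apply: Amin' => //.
  have arith t ut x ux y uy i : (ut - t <= ux - x -> ut - t <= uy - y -> t <= ut ->
    x <= ux -> y <= uy -> y + x = t + t -> uy + i = ut + ut -> ux <= i ->
    ux - x <= ut - t)%N by clear; lia.
  exact: arith XA YA lA lX lY dXY dUXY UX.
have AA : (A * A <= A)%VS.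
  apply/prodvP => x y xA yA; have [->|yNZ] := eqVneq y 0; first by rewrite mulr0 mem0v.
  by rewrite -(stable y) // memv_prod_line.
have Aalg : is_aspace A by rewrite /is_aspace has_algid1.
pose E : {subfield L} := ASpace Aalg.
have UAE : (E * (U * A))%VS = (U * A)%VS.
  by apply: field_module_eq => /=; rewrite prodvCA prodvSr.
have [c dUA] : exists c, \dim (U * A)%VS = (c * \dim A)%N.
  by apply/dvdnP/(@field_module_dimS _ _ E); rewrite UAE.
have NUA (M : {subfield L}) : (U * A)%VS = M -> False.
  move=> UAM; case/eqP: UA; rewrite NAN; apply/eqP; rewrite eqEsubv UAN /= UAM.
  by apply: Ngen; rewrite -UAM; apply/subvP => u uU; rewrite -[u]mulr1 memv_mul.
have UUA : (\dim U <= \dim (U * A)%VS)%N.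
  by apply/dimvS/subvP => u uU; rewrite -[u]mulr1 memv_mul.
have dA := dim0 ANZ.
(* Here [\dim U <= c * \dim A] and [delta A = (c - 1) * \dim A]. For [c = 1] or [c = 2], [U * A]
   would be the field [E] or a quadratic extension [E(x)], which [NUA] excludes. *)
suff c3 : (3 <= c)%N.
  have arith (u ua a0 : nat) : (ua = c * a0 -> u <= ua -> 2 * u <= 3 * (ua - a0))%N by move: c3; clear; nia.
  exact: arith dUA UUA.
have c1 : (1 <= c)%N.
  by rewrite lt0n; apply: contraTneq dA => c0; rewrite -leqNgt (leq_trans (leqU A)) // dUA c0.
rewrite leqNgt; apply/negP => c_lt3.
have [cE|cN1] := eqVneq c 1%N.
  apply: (NUA E); apply/esym/eqP; rewrite eqEdim subUN /= dUA cE mul1n //.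
have cE : c = 2%N by move: c1 cN1 c_lt3; case: (c) => [|[|[|]]].
have /subvPn[x xU xA] : ~~ (U <= A)%VS.
  apply/negP => /= UsubA; apply: (NUA E); apply/eqP; rewrite eqEsubv subUN andbT.
  by rewrite (subv_trans _ AA) // prodvSl.
have adj2 := @adjoin_degree_sqrt E x (sq x) xA.
apply: (NUA <<E; x>>%AS); apply/esym/eqP; rewrite eqEdim dim_Fadjoin dUA cE.
rewrite adj2 leqnn andbT.
rewrite [X in (X <= _)%VS](_ : _ = Fadjoin_sum E x); last exact: Fadjoin_eq_sum.
rewrite /Fadjoin_sum.
rewrite adj2.
rewrite !big_ord_recl big_ord0 addv0 /= expr0 expr1 prodv1 subv_add subUN /=.
by rewrite prodvC prodvSl // -memvE.
Qed.

(* Linear analogue of Olson's theorem on product sets. *)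
Lemma olson X : X != 0%VS -> (U * X)%VS != (N * X)%VS ->
  (2 * \dim U <= 3 * (\dim (U * X)%VS - \dim X))%N.
Proof.
move=> XNZ UX.
have [|A [PA Amin Amin']] := @atom X; first by rewrite /P XNZ.
suff h : (2 * \dim U <= 3 * delta A)%N.
  by rewrite (leq_trans h) // leq_mul2l /= Amin // /P XNZ.
(* Without such a [b], [N * A = A] and hence [U * A = N * A]. Dividing by [b] normalizes [A] so that
   it contains 1 but not [N]. *)
have [b bA Nb] : exists2 b, b \in A & ~~ (<[b]> * N <= A)%VS.
  apply: contrapT => h; case/andP: PA => _ /eqP; apply.
  have {}h a : a \in A -> (<[a]> * N <= A)%VS.
    by move=> aA; apply: contrapT => /negP aN; apply: h; exists a.
  have NA : (N * A)%VS = A.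
    apply: field_module_eq; rewrite prodvC; apply/prodvP => a y aA yN.
    apply: (subvP (h _ aA)).
    by rewrite memv_mul ?memv_line.
  by apply/eqP; rewrite eqEsubv NA subUN -{2}NA prodvSl.
have bNZ : b != 0 by apply: contraNneq Nb => ->; rewrite prod0v sub0v.
pose A1 := (A * <[b^-1]>)%VS; have bVNZ : b^-1 != 0 by rewrite invr_eq0.
rewrite -(delta_scale A bVNZ); apply: atom_excess => [|||Y PY|Y PY].
- exact: P_scale.
- by rewrite -(divff bNZ) memv_prod_line.
- apply: contra Nb => NA1; rewrite prodvC -(prodv_lineK A bVNZ) invrK.
  exact: prodvSl.
- by rewrite delta_scale // Amin.
- by rewrite delta_scale // dim_cosetv //; apply: Amin'.
Qed.
End Olson.

(** * A multiple of the norm degree close to [\dim V] *)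

Section Core.
Variables (B : fieldType) (L : fieldExtType B).
Implicit Types (U V X Y : {vspace L}) (u : L).
Hypothesis sq : forall x : L, x ^+ 2 \in 1%VS.

Lemma prodv_line_sq u : (<[u]> * <[u]> <= 1%VS)%VS.
Proof. by rewrite prodv_line -expr2 -memvE. Qed.

(** As [u ^+ 2] is a scalar, [X + X u] is the [B[u]]-module generated by [X]. *)
Lemma mul_sum_line u X : ((X + X * <[u]>) * <[u]> <= X + X * <[u]>)%VS.
Proof.
rewrite prodvDl -prodvA addvC addvS // -{2}[X]prodv1 prodvSr //; exact: prodv_line_sq.
Qed.

Lemma sum_line_mul u X Y W : (X * Y <= W + W * <[u]>)%VS ->
  ((X + X * <[u]>) * Y <= W + W * <[u]>)%VS.
Proof.
move=> XY; rewrite prodvDl subv_add XY /= prodvAC.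
exact: subv_trans (prodvSl _ XY) (mul_sum_line _ _).
Qed.

Lemma dim_cap_sum_line u X : u != 0 ->
  (\dim (X + X * <[u]>)%VS + \dim (X :&: X * <[u]>)%VS = 2 * \dim X)%N.
Proof. by move=> uNZ; rewrite dimv_sum_cap dim_cosetv // mul2n addnn. Qed.

(** The field [B[Z]] has dimension [2 ^ j], with [\dim Z <= 2 ^ j], and [W] is a space over it, so
    [\dim W = c * 2 ^ j]. If [j <= s + 1] and [\dim W < 2 ^ (s + 1)], then [\dim W + \dim Z <= (c +
    1) * 2 ^ j <= 2 ^ (s + 1)], although this sum is [2 * \dim U]. If [j > s + 1], it is enough that
    [W] is nonzero. *)
Lemma dim_sum_line_ge U u s : u != 0 -> (2 ^ s < \dim U)%N ->
  (U * (U :&: U * <[u]>) <= U + U * <[u]>)%VS ->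
  (2 ^ s.+1 <= \dim (U + U * <[u]>)%VS)%N.
Proof.
move=> uNZ Us UZ; set Z := (U :&: _)%VS in UZ; set W := (U + _)%VS in UZ *.
have [j dH] := dim_subfield_pow2 (agenv_aspace Z) sq.
have HW : (agenv Z * W <= W)%VS.
  by apply: agenv_modl; rewrite prodvC; apply: sum_line_mul.
have /dvdnP[c dW] := field_module_dimS (F := agenv_aspace Z) HW.
have dZ : (\dim Z <= \dim (agenv_aspace Z))%N by apply/dimvS/sub_agenv.
have := dim_cap_sum_line U uNZ; rewrite -/Z -/W => dWZ.
have W0 : (0 < \dim W)%N by rewrite (leq_trans _ (dimvS (addvSl _ _))) // (leq_trans _ Us).
rewrite dW dH in dWZ dZ W0 *.
have [js|sj] := leqP j s.+1.
  have [e eE] : exists e, (2 ^ s.+1 = e * 2 ^ j)%N by apply/dvdnP; rewrite dvdn_Pexp2l.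
  rewrite eE leq_mul2r; apply/orP; right; rewrite leqNgt; apply/negP => ce.
  have := leq_mul ce (leqnn (2 ^ j)); rewrite -eE mulSn expnS.
  by move: dWZ dZ Us; clear; lia.
have c0 : (0 < c)%N by case: (c) W0.
apply: leq_trans (leq_mul c0 (leqnn _)); rewrite mul1n leq_exp2l //; exact: ltnW.
Qed.

(** The multiple is [\dim (U' * Z)], or 0 when [Z = 0]. If [U' * Z] were not an [N]-space, Olson's
    inequality would give [3 * (\dim W - \dim Z) >= 2 * \dim U' >= 4 * 2 ^ s], whereas [\dim W -
    \dim Z = 2 * (\dim W - \dim V) <= 2 ^ s]. *)
Lemma near_multiple U V u s : 1 \in U -> u != 0 -> u \in U ->
  (2 ^ s < \dim U)%N ->
  (U * (U :&: U * <[u]>) <= U + U * <[u]>)%VS ->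
  (U * (V :&: V * <[u]>) <= V + V * <[u]>)%VS ->
  (2 * (\dim (V + V * <[u]>)%VS - \dim V) <= 2 ^ s)%N ->
  exists c, (\dim (V :&: V * <[u]>)%VS <= c * \dim (agenv U) <= \dim (V + V * <[u]>)%VS)%N.
Proof.
move=> U1 uNZ uU Us hU hV ks.
have dU1 := dim_sum_line_ge uNZ Us hU.
have dVZ := dim_cap_sum_line V uNZ.
have U1V := sum_line_mul hV.
have dle : (\dim (V :&: V * <[u]>)%VS <= \dim V)%N by rewrite dimvS ?capvSl.
set W := (V + _)%VS in hV ks dVZ U1V *; set Z := (V :&: _)%VS in hV dVZ U1V dle *.
set U' := (U + _)%VS in dU1 U1V.
have [Z0|ZNZ] := eqVneq Z 0%VS.
  by exists 0%N; rewrite Z0 dimv0 mul0n !leq0n.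
have UU' : (U <= U')%VS by exact: addvSl.
have [UZ|UZ] := eqVneq (U' * Z)%VS (agenv_aspace U * Z)%VS.
  have NUZ : (agenv_aspace U * (U' * Z) <= U' * Z)%VS by rewrite UZ prodvA prodv_id.
  have /dvdnP[c dUZ] := field_module_dimS NUZ.
  exists c; rewrite -[X in (_ * X)%N]/(\dim (agenv_aspace U)) -dUZ.
  rewrite [X in _ && X]dimvS // andbT dimvS //.
  by rewrite UZ; apply: field_subvMl.
have U'1 : 1 \in U' by rewrite (subvP UU').
have U'N : (U' <= agenv_aspace U)%VS.
  rewrite subv_add sub_agenv /= prodv_sub ?sub_agenv //.
  by rewrite -memvE (subvP (sub_agenv U)).
have hgen (M : {subfield L}) : (U' <= M)%VS -> (agenv_aspace U <= M)%VS.
  move=> UM; apply: agenv_sub_modl (sub1v _) _; apply: prodv_sub => //.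
  exact: subv_trans UM.
have h := olson U'1 U'N hgen sq ZNZ UZ.
have arith a b w v z n : (2 * a <= 3 * (b - z) -> 2 * n <= a -> b <= w ->
   w + z = 2 * v -> 2 * (w - v) <= n -> z <= v -> 0 < n -> False)%N by clear; lia.
rewrite expnS in dU1.
by case: (arith _ _ _ _ _ _ h dU1 (dimvS U1V) dVZ ks dle); rewrite expn_gt0.
Qed.
End Core.

(** * Polynomials over an infinite field, and perturbed free families *)

Section InfiniteField.
Variable R : fieldType.
Hypothesis infR : forall p : {poly R}, p != 0 -> exists x, p.[x] != 0.

(** An exponent [m] splits into its last entry and the remaining ones [r m], so every coefficient of
    [P] can be read off [muni P]. *)
Lemma muni_eq0 n (P : {mpoly R[n.+1]}) : muni P = 0 -> P = 0.
Proof.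
move=> P0; apply/mpolyP => m; rewrite mcoeff0.
pose r (m' : 'X_{1..n.+1}) := [multinom m' (widen_ord (leqnSn n) i) | i < n].
have := congr1 (fun q : {poly {mpoly R[n]}} => q`_(m ord_max)@_(r m)) P0.
rewrite /= coef0 mcoeff0 muniE coef_sum raddf_sum /= => sum0.
have sumE : \sum_(m' <- msupp P) P@_m' * (m' == m)%:R = P@_m.
  have [mP|mP] := boolP (m \in msupp P).
    rewrite (bigD1_seq m) ?msupp_uniq //= eqxx mulr1 big1 ?addr0 // => i /negPf ->.
    by rewrite mulr0.
  rewrite (memN_msupp_eq0 mP) big_seq big1 // => i iP.
  by case: eqP mP iP => [-> /negPf -> //|_ _ _]; rewrite mulr0.
rewrite -sumE -[RHS]sum0; apply: eq_bigr => m' _.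
rewrite coefZ coefXn; have [h2|h2] := eqVneq (m ord_max) (m' ord_max); last first.
  have m'N : m' != m by apply: contraNneq h2 => ->.
  by rewrite (negPf m'N) !mulr0 mcoeff0.
rewrite mulr1 mcoeffZ mcoeffX; congr (_ * (nat_of_bool _)%:R).
apply/eqP/eqP => [->//|h1].
apply/mnmP => i; have [[j ->]|->] : (exists j, i = widen_ord (leqnSn n) j) \/ i = ord_max.
- have [i_lt|i_ge] := ltnP i n; [left; exists (Ordinal i_lt)|right]; apply/val_inj => //=.
  by apply/eqP; rewrite eqn_leq i_ge -ltnS ltn_ord.
- by move/mnmP/(_ j): h1; rewrite !mnmE.
- by rewrite h2.
Qed.

Lemma meval_muni n (P : {mpoly R[n.+1]}) (v : 'I_n -> R) x :
  P.@[fun i => if unlift ord_max i is Some j then v j else x] =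
  (map_poly (meval v) (muni P)).[x].
Proof.
rewrite muniE rmorph_sum horner_sum /= mevalE; apply: eq_bigr => m _.
rewrite linearZ_LR /= map_polyXn hornerZ hornerXn mevalZ mevalX -mulrA.
congr (_ * _); rewrite big_ord_recr /= unlift_none; congr (_ * _).
apply: eq_bigr => i _; rewrite mnmE.
have -> : widen_ord (leqnSn n) i = lift ord_max i.
  by apply/val_inj; rewrite /= /bump leqNgt ltn_ord.
by rewrite liftK.
Qed.

Lemma meval_neq0 n (P : {mpoly R[n]}) : P != 0 -> exists v, P.@[v] != 0.
Proof.
elim: n P => [|n IHn] P PNZ.
  exists (fun=> 0); rewrite (nvar0_mpolyC P) mevalC.
  by apply: contraNneq PNZ => P0; rewrite (nvar0_mpolyC P) P0.
have : muni P != 0 by apply: contraNneq PNZ => /muni_eq0 ->.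
rewrite -lead_coef_eq0 => /IHn[v vP].
have : map_poly (meval v) (muni P) != 0.
  apply: contraNneq vP => /(congr1 (fun q : {poly R} => q`_(size (muni P)).-1)).
  by rewrite coef_map coef0 /= => ->.
by case/infR => x xP; exists (fun i => if unlift ord_max i is Some j then v j else x);
  rewrite meval_muni.
Qed.
End InfiniteField.

(** Freeness is an open condition. With [C] the matrix of coordinates of the second components along
    the first ones, the polynomial is [\det (1 + x C)], equal to 1 at 0. Applying [coord X] to a
    linear relation turns it into a kernel vector of an invertible matrix. *)
Lemma free_perturb (B : fieldType) (V : vectType B) (s : seq (V * V)) :
  free (unzip1 s) -> exists2 p : {poly B}, p.[0] != 0 &
    forall x, p.[x] != 0 -> free [seq c.1 + x *: c.2 | c <- s].
Proof.
move=> s_free; pose n := size s; pose X := [tuple (s`_i).1 | i < n].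
have XE : unzip1 s = X :> seq V.
  apply: (@eq_from_nth _ 0); rewrite ?[size X]size_tuple ?size_map // => i i_s.
  by rewrite (nth_map 0) // (nth_mktuple _ _ (Ordinal i_s)).
have X_free : free X by rewrite -XE.
pose C := \matrix_(i < n, j < n) coord X i (s`_j).2.
pose M := map_mx polyC 1%:M + 'X *: map_mx polyC C.
have ME x : map_mx (horner_eval x) M = 1%:M + x *: C.
  by apply/matrixP => i j; rewrite !mxE /horner_eval !hornerE.
have detE x : (\det M).[x] = \det (1%:M + x *: C).
  by rewrite -[LHS]/(horner_eval x _) -det_map_mx ME.
exists (\det M) => [|x]; first by rewrite detE scale0r addr0 det1 oner_eq0.
rewrite detE -unitfE -[_ \is a _]/(_ \in unitmx) => Munit.
pose Y := [tuple (s`_i).1 + x *: (s`_i).2 | i < n].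
have -> : [seq c.1 + x *: c.2 | c <- s] = Y :> seq V.
  apply: (@eq_from_nth _ 0); rewrite ?[size Y]size_tuple ?size_map // => i i_s.
  by rewrite (nth_map 0) // (nth_mktuple _ _ (Ordinal i_s)).
apply/freeP => k kY i.
suff /colP/(_ i) : (\col_j k j) = 0 :> 'cV_n by rewrite !mxE.
rewrite -[LHS](mulKmx Munit) -[RHS](mulmx0 _ (invmx (1%:M + x *: C))).
congr (_ *m _); apply/colP => l; rewrite !mxE.
have := congr1 (coord X l) kY; rewrite linear0 linear_sum => kl.
rewrite -[RHS]kl; apply: eq_bigr => j _.
rewrite linearZ_LR -tnth_nth tnth_mktuple linearD linearZ_LR /=.
rewrite !mxE mulrC; congr (_ * (_ + _)).
by rewrite -[(s`_j).1](tnth_mktuple (fun j : 'I_n => (s`_j).1) j) (tnth_nth 0) coord_free // eq_sym.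
Qed.

(** * Choice of a generic multiplier *)

Section Select.
Variables (B : fieldType) (L : fieldExtType B).
Implicit Types (U V : {vspace L}) (u w z : L).

(** A basis of [V + V u] is deformed into [V + V (u + x w)]: vectors of [V] stay fixed, and [z * u]
    moves to [z * (u + x w)]. It stays free for generic [x], even after adding the family [t]. *)
Lemma sum_line_perturb_seq V u w (t : seq (L * L)) : u != 0 ->
  free (vbasis V ++ vbasis (V * <[u]> :\: V)%VS ++ unzip1 t) ->
  exists2 p : {poly B}, p.[0] != 0 & forall x, p.[x] != 0 ->
    (forall c, c \in t -> c.1 + x *: c.2 \in (V + V * <[u + x *: w]>)%VS) ->
    (\dim (V + V * <[u]>)%VS + size t <= \dim (V + V * <[u + x *: w]>)%VS)%N.
Proof.
move=> uNZ; set C := (_ :\: _)%VS.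
pose s := [seq (c, 0) | c <- vbasis V] ++ [seq (c, c / u * w) | c <- vbasis C] ++ t.
have -> : vbasis V ++ vbasis C ++ unzip1 t = unzip1 s.
  rewrite /s /unzip1 !map_cat -!map_comp /comp /=.
  by congr (_ ++ (_ ++ _)); rewrite map_id.
case/free_perturb => p p0 hp; exists p => // x /hp free_x tx.
have CE c : c \in vbasis C -> exists2 z, z \in V & c = z * u.
  by move/vbasis_mem => /(subvP (diffvSl _ _))/memv_cosetP[z zV ->]; exists z.
have dimE : (\dim (V + V * <[u]>)%VS = \dim V + \dim C)%N.
  rewrite /C -(dimv_disjoint_sum (U := V) (V := C)) /C; last first.
    by rewrite capvC capv_diff.
  congr (\dim _); apply/eqP; rewrite eqEsubv !subv_add addvSl /=.
  rewrite addvSl /= (subv_trans (diffvSl _ _) (addvSr _ _)) andbT.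
  rewrite -{1}(addv_diff_cap (V * <[u]>) V) subv_add addvSr /=.
  by rewrite (subv_trans (capvSr _ _) (addvSl _ _)).
have -> : (\dim (V + V * <[u]>)%VS + size t = \dim <<[seq c.1 + x *: c.2 | c <- s]%R>>%VS)%N.
  rewrite (eqnP free_x) size_map dimE /s !size_cat !size_map !size_tuple addnA.
  by [].
apply: dimvS; apply/span_subvP => y /mapP[c]; rewrite !mem_cat.
case/orP => [/mapP[v vV ->] ->|/orP[/mapP[v /CE[z zV vz] ->] ->|ct ->]]; last exact: tx.
  by rewrite scaler0 addr0 (subvP (addvSl _ _)) // vbasis_mem.
rewrite /= vz mulfK // scalerAr -mulrDr (subvP (addvSr _ _)) //.
by rewrite memv_mul ?memv_line.
Qed.

Let free_sum_line V u :
  free (vbasis V ++ vbasis (V * <[u]> :\: V)%VS) /\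
  (<<vbasis V ++ vbasis (V * <[u]> :\: V)%VS>> <= V + V * <[u]>)%VS.
Proof.
rewrite cat_free !(basis_free (vbasisP _)) span_cat !(span_basis (vbasisP _)) /=.
rewrite (sameP directv_addP eqP) /= capvC capv_diff eqxx; split=> //.
by rewrite subv_add addvSl (subv_trans (diffvSl _ _) (addvSr _ _)).
Qed.

Lemma sum_line_perturb V u w : u != 0 ->
  exists2 p : {poly B}, p.[0] != 0 & forall x, p.[x] != 0 ->
    (\dim (V + V * <[u]>)%VS <= \dim (V + V * <[u + x *: w]>)%VS)%N.
Proof.
move=> uNZ; have [|p p0 hp] := @sum_line_perturb_seq V u w [::] uNZ.
  by rewrite cats0; case: (free_sum_line V u).
by exists p => // x /hp; rewrite addn0; apply.
Qed.

(** The additional dimension comes from [z * w]: it lies outside [V + V u], but equals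
    [x^-1 *: (z * (u + x *: w) - z * u)], which is in [V + V (u + x w)]. *)
Lemma sum_line_perturb_lt V u w z : u != 0 -> z \in V -> z * u \in V ->
  z * w \notin (V + V * <[u]>)%VS ->
  exists2 p : {poly B}, p.[0] != 0 & forall x, p.[x] != 0 -> x != 0 ->
    (\dim (V + V * <[u]>)%VS < \dim (V + V * <[u + x *: w]>)%VS)%N.
Proof.
move=> uNZ zV zuV zw.
have [|p p0 hp] := @sum_line_perturb_seq V u w [:: (z * w, 0)] uNZ.
  have [h1 h2] := free_sum_line V u.
  rewrite catA (perm_free (_ : perm_eq _ (z * w :: (vbasis V ++ vbasis (V * <[u]> :\: V)%VS)))).
    by rewrite free_cons h1 andbT; apply: contra zw; apply: subvP.
  by rewrite -cat1s perm_catC.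
exists p => // x /hp h xNZ; rewrite -addn1; apply: h => c; rewrite inE => /eqP ->.
have -> : (z * w, 0 : L).1 + x *: (z * w, 0 : L).2 = x^-1 *: (z * (u + x *: w) - z * u).
  by rewrite /= scaler0 addr0 mulrDr addrAC subrr add0r -scalerAr scalerA mulVf ?scale1r.
apply: rpredZ; apply: rpredB; last by rewrite (subvP (addvSl _ _)).
by rewrite (subvP (addvSr _ _)) // memv_mul ?memv_line.
Qed.

Hypothesis infB : forall p : {poly B}, p != 0 -> exists x, p.[x] != 0.
Hypothesis sq : forall x : L, x ^+ 2 \in 1%VS.
Variables (m : nat) (a : 'I_m -> L).

Definition lincomb (v : 'I_m -> B) : L := \sum_i v i *: a i.

Lemma lincomb_line (v w : 'I_m -> B) x :
  lincomb (fun i => v i + x * w i) = lincomb v + x *: lincomb w.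
Proof.
rewrite /lincomb scaler_sumr -big_split; apply: eq_bigr => i _.
by rewrite scalerDl scalerA.
Qed.

Lemma meval_line (P : {mpoly B[m]}) (v w : 'I_m -> B) :
  exists r : {poly B}, forall x, r.[x] = P.@[fun i => v i + x * w i].
Proof.
exists (mmap polyC (fun i => (v i)%:P + (w i)%:P * 'X) P) => x.
rewrite mevalE /mmap horner_sum; apply: eq_bigr => mm _.
rewrite hornerM hornerC /mmap1 horner_prod; congr (_ * _); apply: eq_bigr => i _.
by rewrite horner_exp !hornerE mulrC.
Qed.

(** Choose [v] maximizing the sum [f v] of both dimensions on the locus [P != 0]. If an inclusion
    failed for [w], then for some [x] the point [v + x w] would stay in this locus, increase one
    dimension and not decrease the other. *)
Lemma exists_generic_lincomb (P : {mpoly B[m]}) U V : P != 0 ->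
  (forall v, P.@[v] != 0 -> lincomb v != 0) ->
  exists v, P.@[v] != 0 /\ forall w : 'I_m -> B,
    ((V :&: V * <[lincomb v]>) * <[lincomb w]> <= V + V * <[lincomb v]>)%VS /\
    ((U :&: U * <[lincomb v]>) * <[lincomb w]> <= U + U * <[lincomb v]>)%VS.
Proof.
move=> PNZ hP.
pose f v := (\dim (V + V * <[lincomb v]>)%VS + \dim (U + U * <[lincomb v]>)%VS)%N.
have ex1 : exists d, `[< exists2 v, P.@[v] != 0 & f v = d >].
  by have [v vP] := meval_neq0 infB PNZ; exists (f v); apply/asboolP; exists v.
have ub d : `[< exists2 v, P.@[v] != 0 & f v = d >] -> (d <= \dim {:L} + \dim {:L})%N.
  by move=> /asboolP[v _ <-]; rewrite leq_add // dimvS ?subvf.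
case: (ex_maxnP ex1 ub) => d /asboolP[v vP fv] dmax; exists v; split=> // w.
set u := lincomb v; have uNZ : u != 0 by apply: hP.
have [pV pV0 hV] := sum_line_perturb V (lincomb w) uNZ.
have [pU pU0 hU] := sum_line_perturb U (lincomb w) uNZ.
have [r rE] := meval_line P v w.
have r0 : r.[0] != 0.
  by rewrite rE (meval_eq (v2 := v)) // => i; rewrite mul0r addr0.
have main (W : {vspace L}) : (exists2 z, z \in W & z * u \in W /\
     z * lincomb w \notin (W + W * <[u]>)%VS) ->
    (forall x, pV.[x] != 0 -> pU.[x] != 0 ->
      (\dim (W + W * <[u]>)%VS < \dim (W + W * <[u + x *: lincomb w]>)%VS)%N ->
      (f v < f (fun i => (v i + x * w i)%R))%N) -> False.
  move=> [z zW [zuW zw]] hW; have [p p0 hp] := sum_line_perturb_lt uNZ zW zuW zw.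
  have [|x] := infB (p := pV * pU * (r * p * 'X)).
    rewrite !mulf_neq0 ?polyX_eq0 //.
    - by apply: contraNneq pV0 => ->; rewrite horner0.
    - by apply: contraNneq pU0 => ->; rewrite horner0.
    - by apply: contraNneq r0 => ->; rewrite horner0.
    - by apply: contraNneq p0 => ->; rewrite horner0.
  rewrite !hornerM hornerX !mulf_eq0 !negb_or => /andP[/andP[xV xU] /andP[/andP[xr xp] xNZ]].
  have := hW _ xV xU (hp _ xp xNZ); rewrite ltnNge fv => /negP; apply.
  by apply: dmax; apply/asboolP; exists (fun i => v i + x * w i); rewrite -?rE.
(* If [z = y * u] with [y] in [W], then [z * u] is a scalar multiple of [y]. *)
have stab (W : {vspace L}) z : z \in (W :&: W * <[u]>)%VS -> z \in W /\ z * u \in W.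
  rewrite memv_cap => /andP[zW /memv_cosetP[y yW zE]]; split=> //.
  have /vlineP[b bE] := sq u.
  by rewrite zE -mulrA -expr2 bE -scalerAr mulr1 rpredZ.
have fE x : f (fun i => v i + x * w i) =
   (\dim (V + V * <[(u + x *: lincomb w)%R]>)%VS + \dim (U + U * <[(u + x *: lincomb w)%R]>)%VS)%N.
  by rewrite /f lincomb_line.
split; apply/prodvP => z y /stab[zW zuW] /vlineP[b ->]; rewrite -scalerAr rpredZ //;
  apply: contraT => zw; exfalso.
- apply: (main V); first by exists z.
  by move=> x /hV _ /hU hUx hVx; rewrite fE /f -addSn leq_add.
- apply: (main U); first by exists z.
  by move=> x /hV hVx /hU _ hUx; rewrite fE /f -addnS leq_add.
Qed.


End Select.

(** * Finite extensions of the field of squares *)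

Section FrobeniusExtension.
Variables (F : fieldType) (char2 : 2%N \in [pchar F]).

Lemma sqrrD_char2 (x y : F) : (x + y) ^+ 2 = x ^+ 2 + y ^+ 2.
Proof. by rewrite -!(pFrobenius_autE char2) rmorphD. Qed.

Lemma sqr_inj_char2 : injective (fun x : F => x ^+ 2).
Proof. by move=> x y; rewrite -!(pFrobenius_autE char2); apply: fmorph_inj. Qed.

(* [L] is the subfield [F^2(s)] of [F]; the scalar [c : F] acts on it as [c ^ 2]. *)
Lemma exists_sqr_ext (s : seq F) : exists (L : fieldExtType F) (j : {rmorphism L -> F}),
  (forall c, j c%:A = c ^+ 2) /\ forall x, x \in s -> exists y, j y = x.
Proof.
elim: s => [|x s [L [j [jA js]]]].
  (* The field [F] itself models [F^2], embedded by the Frobenius map. *)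
  exists F^o, (pFrobenius_aut char2 : {rmorphism F -> F}); split=> // c.
  by rewrite /= pFrobenius_autE /GRing.scale /= mulr1.
have [[y jy]|jx] := pselect (exists y, j y = x).
  by exists L, j; split=> // z; rewrite inE => /predU1P[->|/js //]; exists y.
(* Under [j] this becomes [X^2 - x^2]. A root [y] in [L] would satisfy [j y = x], by injectivity of
   squaring; hence [p] is irreducible. *)
pose p : {poly L} := 'X^2 - x%:A%:P.
have sz_p : size p = 3%N by rewrite size_XnsubC.
have pz : root (map_poly j p) x.
  by rewrite rmorphB /= map_polyXn map_polyC /= jA rootE !hornerE subrr.
have p_irr : irreducible_poly p.
  apply: cubic_irreducible; rewrite ?sz_p // => y; apply/negP.
  rewrite rootE !hornerE subr_eq0 => /eqP yx; apply: jx; exists y.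
  by apply: sqr_inj_char2; rewrite -rmorphXn yx jA.
pose L1 := SubFieldExtType pz p_irr.
pose j1 : {rmorphism L1 -> F} := @subfx_inj L F j x p.
have j1A y : j1 y%:A = j y by apply: subfx_inj_base pz (irredp_neq0 p_irr) _.
exists (baseFieldType L1), j1; split=> [c|z].
  by rewrite -jA -j1A baseField_scaleE.
rewrite inE => /predU1P[->|/js[y <-]]; last by exists (y%:A : L1).
by exists (subfx_root j x p); apply: subfx_inj_root pz (irredp_neq0 p_irr).
Qed.
End FrobeniusExtension.

(** * Subspaces given by a predicate *)

Section VectorSubspace.
Variables (F : fieldType) (V : vectType F).

(** A subspace of maximal dimension among those contained in [S] absorbs every [x] satisfying
    [S]. *)
Lemma exists_vspace (S : V -> Prop) : S 0 -> (forall c x y, S x -> S y -> S (c *: x + y)) ->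
  exists U : {vspace V}, forall x, x \in U <-> S x.
Proof.
move=> S0 Slin.
have ex1 : exists d, `[< exists2 U : {vspace V}, forall x, x \in U -> S x & \dim U = d >].
  exists 0%N; apply/asboolP; exists 0%VS; last exact: dimv0.
  by move=> x; rewrite memv0 => /eqP ->.
have ub d : `[< exists2 U : {vspace V}, forall x, x \in U -> S x & \dim U = d >] ->
    (d <= \dim {:V})%N.
  by move=> /asboolP[U _ <-]; rewrite dimvS ?subvf.
case: (ex_maxnP ex1 ub) => d /asboolP[U US dU] dmax; exists U => x; split=> [|Sx].
  exact: US.
have /dmax : `[< exists2 U0 : {vspace V}, forall x, x \in U0 -> S x & \dim U0 = \dim (U + <[x]>)%VS >].
  apply/asboolP; exists (U + <[x]>)%VS => // y /memv_addP[z zU [_ /vlineP[c ->] ->]].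
  by rewrite addrC; apply: Slin => //; apply: US.
by rewrite -dU (geq_leqif (dimv_leqif_sup (addvSl U <[x]>))) subv_add subvv.
Qed.
End VectorSubspace.

(** * Diagonal forms in characteristic 2 *)

Section DiagonalForms.
Variables (F : fieldType) (char2 : 2%N \in [pchar F]).

Lemma qval_diag_form n (a : 'I_n -> F) v :
  qval (diag_form a) v = \sum_i a i * v ord0 i ^+ 2.
Proof.
rewrite /qval /diag_form raddf_sum /=; apply: eq_bigr => i _.
by rewrite mevalZ rmorphXn /= mevalXU.
Qed.

Lemma sum_sqr_char2 (I : Type) (r : seq I) (P : pred I) (f : I -> F) :
  (\sum_(i <- r | P i) f i) ^+ 2 = \sum_(i <- r | P i) f i ^+ 2.
Proof.
rewrite -(pFrobenius_autE char2) rmorph_sum; apply: eq_bigr => i _.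
by rewrite /= pFrobenius_autE.
Qed.

(** Squaring is additive, so a linear change of variables keeps a diagonal form diagonal. *)
Lemma quasilinear_qval n (q : {mpoly F[n]}) : quasilinear q ->
  exists a : 'I_n -> F, forall v, qval q v = \sum_i a i * v ord0 i ^+ 2.
Proof.
case=> _ [a [P Punit qP]].
exists (fun j => \sum_i a i * (invmx P j i) ^+ 2) => v.
rewrite -{1}(mulmxKV Punit v) qP qval_diag_form.
under eq_bigr => i _ do rewrite mxE sum_sqr_char2 mulr_sumr.
rewrite exchange_big /=; apply: eq_bigr => j _; rewrite mulr_suml.
by apply: eq_bigr => i _; rewrite exprMn; ring.
Qed.

(** The form is additive and multiplies by [c ^+ 2] under scaling, so its zeros form a subspace and
    the default of [xget] is not reached. *)
Lemma isotropic_spaceP n (a : 'I_n -> F) v :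
  v \in isotropic_space (diag_form a) <-> qval (diag_form a) v = 0.
Proof.
have [||U hU] := @exists_vspace F 'rV[F]_n (fun v => qval (diag_form a) v = 0).
- by rewrite qval_diag_form big1 // => i _; rewrite mxE expr0n mulr0.
- move=> c x y; rewrite !qval_diag_form => x0 y0.
  transitivity (c ^+ 2 * (\sum_i a i * x ord0 i ^+ 2) + \sum_i a i * y ord0 i ^+ 2).
    rewrite mulr_sumr -big_split; apply: eq_bigr => i _.
    by rewrite !mxE sqrrD_char2 // exprMn /=; ring.
  by rewrite x0 y0 mulr0 addr0.
- rewrite /isotropic_space; set S := (S in xget _ S).
  by have /= := @xgetPex _ 0%VS S (ex_intro S U hU); apply.
Qed.

Section Infinite.
Variables (n : nat) (a : 'I_n -> F).
Hypothesis a_an : forall v : 'I_n -> F, \sum_i a i * v i ^+ 2 = 0 -> forall i, v i = 0.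

Lemma anisotropic_coef_neq0 i : a i != 0.
Proof.
apply/eqP => ai0; suff h : \sum_k a k * (k == i)%:R ^+ 2 = 0.
  by have /eqP := a_an h i; rewrite eqxx oner_eq0.
rewrite big1 // => k _; case: eqVneq => [->|_]; first by rewrite ai0 mul0r.
by rewrite expr0n mulr0.
Qed.

(** By anisotropy [u = a i1 / a i2] is not a square. It is then not a root of unity: for odd [d],
    [u ^+ d = 1] would make [u] the square of [u ^+ (d.+1)./2], and an even [d] can be halved. The
    powers of [u] are thus infinitely many points. *)
Lemma anisotropic_infinite (i1 i2 : 'I_n) : i1 != i2 ->
  forall p : {poly F}, p != 0 -> exists x, p.[x] != 0.
Proof.
move=> i12; pose u := a i1 / a i2.
have u_nsq t : u != t ^+ 2.
  apply/eqP => ut; pose v k : F := if k == i1 then 1 else if k == i2 then t else 0.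
  suff h : \sum_k a k * v k ^+ 2 = 0.
    by have /eqP := a_an h i1; rewrite /v eqxx oner_eq0.
  rewrite (bigD1 i1) //= (bigD1 i2) 1?eq_sym //= big1.
    rewrite /v eqxx eq_sym (negPf i12) eqxx -ut expr1n mulr1 addr0.
    by rewrite mulrCA divff ?anisotropic_coef_neq0 // mulr1 addrr_pchar2.
  by move=> k /andP[/negPf h1 /negPf h2]; rewrite /v h1 h2 expr0n mulr0.
have uNZ : u != 0 by have := u_nsq 0; rewrite expr0n.
have u_ord d : (0 < d)%N -> u ^+ d != 1.
  elim/ltn_ind: d => d IHd d0; have [d_odd|d_even] := boolP (odd d).
    apply/eqP => ud; have := u_nsq (u ^+ (d.+1)./2); case/eqP.
    by rewrite -exprM muln2 even_halfK /= ?d_odd // exprS ud mulr1.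
  rewrite -(even_halfK d_even) -muln2 exprM; apply/eqP => /eqP.
  rewrite -[X in _ == X](expr1n _ 2) (inj_eq (sqr_inj_char2 char2)); apply/negP.
  by apply: IHd; rewrite -?divn2; move: d_even d0; lia.
move=> p pNZ; apply: contrapT => h.
have rs : uniq [seq u ^+ i | i <- iota 0 (size p)].
  rewrite map_inj_in_uniq ?iota_uniq // => i j _ _.
  wlog ij : i j / (i <= j)%N => [hw|] uij.
    by case/orP: (leq_total i j) => ij; [|apply/esym]; apply: hw.
  apply/eqP; rewrite eqn_leq ij leqNgt; apply/negP => ji.
  have := u_ord (j - i)%N; rewrite subn_gt0 => /(_ ji)/eqP; apply.
  apply: (mulfI (expf_neq0 i uNZ)).
  by rewrite -exprD subnKC // mulr1.
suff pr : all (root p) [seq u ^+ i | i <- iota 0 (size p)].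
  by have := max_poly_roots pNZ pr rs; rewrite size_map size_iota ltnn.
apply/allP => _ /mapP[i _ ->]; rewrite rootE; apply: contraT => px.
by case: h; exists (u ^+ i).
Qed.
End Infinite.

(** Over an infinite field the values determine the polynomial. Equality of polynomials is what
    scalar extension and the function field require. *)
Lemma quasilinear_diag_form n (q : {mpoly F[n]}) (a : 'I_n -> F) :
  (forall p : {poly F}, p != 0 -> exists x, p.[x] != 0) ->
  (forall v, qval q v = \sum_i a i * v ord0 i ^+ 2) -> q = diag_form a.
Proof.
move=> infF qE; apply/eqP; rewrite -subr_eq0; apply: contraT => /(meval_neq0 infF)[v].
have vE (r : {mpoly F[n]}) : r.@[v] = qval r (\row_i v i).
  by apply: meval_eq => i; rewrite mxE.
by rewrite vE /qval mevalB -!/(qval _ _) qE qval_diag_form subrr eqxx.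
Qed.

Lemma anisotropic_diag_form n (a : 'I_n -> F) q :
  (forall v, qval q v = \sum_i a i * v ord0 i ^+ 2) -> anisotropic q ->
  forall v : 'I_n -> F, \sum_i a i * v i ^+ 2 = 0 -> forall i, v i = 0.
Proof.
move=> qE /eqP; rewrite /isotropy_index dimv_eq0 => /eqP q_an v v0 i.
have : \row_i v i \in isotropic_space q.
  have -> : isotropic_space q = isotropic_space (diag_form a).
    rewrite /isotropic_space; congr (xget _ _); apply/funext => U; apply/propext.
    by split=> h x; rewrite h qE qval_diag_form.
  apply/isotropic_spaceP; rewrite qval_diag_form -[RHS]v0.
  by apply: eq_bigr => k _; rewrite mxE.
by rewrite q_an memv0 => /eqP/rowP/(_ i); rewrite !mxE.
Qed.
End DiagonalForms.

(** * Specialization of isotropic vectors to points of the quadric *)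

Section Specialization.
Variables (F : fieldType) (char2 : 2%N \in [pchar F]).

(** Write a basis of the isotropic space over [F(p)] with fractions and clear denominators by their
    product [G]. The rows become polynomial vectors, isotropic modulo [p]; their independence yields
    a maximal minor that [p] does not divide. *)
Lemma isotropy_relations m n (p : {mpoly F[m]}) (b : 'I_n -> F)
    (Fp : fieldType) (iota : {rmorphism F -> Fp})
    (i := isotropy_index (map_mpoly iota (diag_form b))) :
  is_function_field p iota ->
  exists (f : 'M[{mpoly F[m]}]_(i, n)) (sigma : 'I_i -> 'I_n),
    ~ (exists g, \det (colsub sigma f) = g * p) /\
    forall r, exists g, \sum_j (b j)%:MP * f r j ^+ 2 = g * p.
Proof.
case=> K [j [e [eP eC jP]]].
have mapE : map_mpoly iota (diag_form b) = diag_form (iota \o b).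
  rewrite /diag_form rmorph_sum; apply: eq_bigr => k _ /=.
  by rewrite map_mpolyZ rmorphXn /= map_mpolyX.
have char2p : 2%N \in [pchar Fp] by rewrite (fmorph_pchar iota).
pose W := isotropic_space (map_mpoly iota (diag_form b)).
pose M : 'M[Fp]_(i, n) := \matrix_(r, c) (vbasis W)`_r ord0 c.
have M_free : row_free M.
  have : free (vbasis W) by apply: basis_free (vbasisP _).
  move/freeP => W_free; apply: inj_row_free => k kM.
  apply/rowP => r; rewrite mxE; apply: (W_free (fun r => k ord0 r)).
  apply/rowP => c; rewrite mxE summxE; transitivity ((k *m M) ord0 c); last by rewrite kM mxE.
  by rewrite mxE; apply: eq_bigr => l _; rewrite !mxE.
have W_isot x : x \in W -> \sum_c iota (b c) * x ord0 c ^+ 2 = 0.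
  by rewrite /W mapE => /(isotropic_spaceP char2p); rewrite qval_diag_form.
have M_isot r : \sum_c iota (b c) * M r c ^+ 2 = 0.
  rewrite -[RHS](W_isot (vbasis W)`_r); first by apply: eq_bigr => c _; rewrite mxE.
  by rewrite vbasis_mem // mem_nth ?size_tuple.
have fracP (rc : 'I_i * 'I_n) : exists fg : {mpoly F[m]} * {mpoly F[m]},
    e fg.2 != 0 /\ j (M rc.1 rc.2) = e fg.1 / e fg.2.
  have [|d [f [g [_ _ gNZ ->]]]] := (jP (j (M rc.1 rc.2))).1; first by exists (M rc.1 rc.2).
  by exists (f, g).
have [fg fgP] := choice fracP.
pose G := \prod_rc (fg rc).2.
have eG : e G != 0.
  by rewrite rmorph_prod; apply/prodf_neq0 => rc _; case: (fgP rc).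
pose f := \matrix_(r < i, c < n) ((fg (r, c)).1 * \prod_(rc | rc != (r, c)) (fg rc).2).
have ef r c : e (f r c) = e G * j (M r c).
  have [gNZ ->] := fgP (r, c); rewrite mxE rmorphM /G [in RHS](bigD1 (r, c)) //= rmorphM.
  by field.
have ef_mx : map_mx e f = e G *: map_mx j M.
  by apply/matrixP => r c; rewrite mxE ef !mxE.
have ef_full : row_full (map_mx e f)^T.
  rewrite /row_full mxrank_tr -/(row_free _) ef_mx.
  by rewrite /row_free mxrank_scale_nz // mxrank_map.
exists f, (fullrankfun ef_full); split=> [[g]|r].
  move/(congr1 e); rewrite (eP (g * p)).2; last by exists g.
  rewrite -det_map_mx => /eqP; apply/negP.
  have := fullrowsub_unit ef_full; rewrite -unitmx_tr unitmxE unitfE.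
  by congr (is_true (\det _ != 0)); apply/matrixP => r c; rewrite !mxE.
apply/eP; rewrite rmorph_sum /=.
transitivity (e G ^+ 2 * j (\sum_c iota (b c) * M r c ^+ 2)); last first.
  by rewrite M_isot rmorph0 mulr0.
rewrite rmorph_sum mulr_sumr; apply: eq_bigr => c _ /=.
by rewrite (rmorphM e) (rmorphM j) (rmorphXn e) (rmorphXn j) /= ef eC; ring.
Qed.

Lemma diag_form_recr m (a : 'I_m.+1 -> F) :
  diag_form a = mwiden (diag_form (fun i => a (widen_ord (leqnSn m) i))) +
    (a ord_max)%:MP * ('X_ord_max * 'X_ord_max).
Proof.
rewrite /diag_form big_ord_recr /= -mul_mpolyC expr2; congr (_ + _).
rewrite rmorph_sum; apply: eq_bigr => i _ /=.
by rewrite mwidenZ rmorphXn /= mwidenX mnmwiden1.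
Qed.

(** Division by the form in the last variable: it expresses the square of that variable through the
    others, so the polynomials with such a remainder are closed under products. *)
Lemma mod_diag_form m (a : 'I_m.+1 -> F) (f : {mpoly F[m.+1]}) : a ord_max != 0 ->
  exists (alpha beta : {mpoly F[m]}) (g : {mpoly F[m.+1]}),
    f = mwiden alpha + mwiden beta * 'X_ord_max + g * diag_form a.
Proof.
move=> aNZ; set p := diag_form a; set x := 'X_ord_max.
pose S h := exists (alpha beta : {mpoly F[m]}) (g : {mpoly F[m.+1]}),
  h = mwiden alpha + mwiden beta * x + g * p.
pose d := diag_form (fun i => a (widen_ord (leqnSn m) i)).
pose c : {mpoly F[m]} := (a ord_max)^-1%:MP.
have xx : x * x = mwiden c * (p - mwiden d).
  rewrite /p diag_form_recr -/d -/x addrC addKr mwidenC mulrA -mpolyCM mulVf // mul1r.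
  by [].
have SD h1 h2 : S h1 -> S h2 -> S (h1 + h2).
  move=> [a1 [b1 [g1 ->]]] [a2 [b2 [g2 ->]]].
  by exists (a1 + a2), (b1 + b2), (g1 + g2); rewrite !mwidenD; ring.
have SM h1 h2 : S h1 -> S h2 -> S (h1 * h2).
  move=> [a1 [b1 [g1 ->]]] [a2 [b2 [g2 ->]]].
  exists (a1 * a2 - b1 * b2 * c * d), (a1 * b2 + b1 * a2),
    (g1 * (mwiden a2 + mwiden b2 * x + g2 * p) + (mwiden a1 + mwiden b1 * x) * g2 +
     mwiden (b1 * b2 * c)).
  rewrite mwidenB mwidenD !mwidenM.
  transitivity (mwiden a1 * mwiden a2 + (mwiden a1 * mwiden b2 + mwiden b1 * mwiden a2) * x +
    mwiden b1 * mwiden b2 * (x * x) +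
    (g1 * (mwiden a2 + mwiden b2 * x + g2 * p) + (mwiden a1 + mwiden b1 * x) * g2) * p).
    move: (mwiden a1) (mwiden a2) (mwiden b1) (mwiden b2) (p) {xx} => *; ring.
  rewrite xx; move: (mwiden a1) (mwiden a2) (mwiden b1) (mwiden b2) (mwiden c) (mwiden d) (p) {xx}.
  move=> *; ring.
have SC k : S k%:MP by exists k%:MP, 0, 0; rewrite mwidenC mwiden0; ring.
have SX i : S 'X_i.
  have [[k ->]|->] : (exists k, i = widen_ord (leqnSn m) k) \/ i = ord_max.
  - have [i_lt|i_ge] := ltnP i m; [left; exists (Ordinal i_lt)|right]; apply/val_inj => //=.
    by apply/eqP; rewrite eqn_leq i_ge -ltnS ltn_ord.
  - by exists 'X_k, 0, 0; rewrite mwidenX mnmwiden1 mwiden0; ring.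
  - by exists 0, 1, 0; rewrite mwiden0 mwiden1 -/x; ring.
have S0 : S 0 by have := SC 0; rewrite mpolyC0.
have S1 : S 1 by have := SC 1; rewrite mpolyC1.
have SXn i e : S ('X_i ^+ e).
  by elim: e => [|e IHe]; rewrite ?expr0 // exprS; apply: SM.
rewrite -/(S f); elim/mpolyind: f => // k mm f _ _ Sf; apply: SD => //.
rewrite -mul_mpolyC; apply: (SM) => //; rewrite mpolyXE_id.
exact: (big_ind S S1 SM (fun i _ => SXn i _)).
Qed.

Section Evaluation.
Variables (m : nat) (v : 'I_m -> F) (u : F).

(* The square of the value of a polynomial at the point
   [(v, sqrt u)] of a purely inseparable extension of [F]. *)
Definition frobenius_eval : {rmorphism {mpoly F[m.+1]} -> F} :=
  mmap (pFrobenius_aut char2 : {rmorphism F -> F})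
    (fun i => if unlift ord_max i is Some k then v k ^+ 2 else u).

Lemma frobenius_evalC c : frobenius_eval c%:MP = c ^+ 2.
Proof. by rewrite /frobenius_eval /= mmapC /= pFrobenius_autE. Qed.

Lemma frobenius_eval_last : frobenius_eval 'X_ord_max = u.
Proof. by rewrite /frobenius_eval /= mmapX mmap1U unlift_none. Qed.

Lemma frobenius_eval_widen f : frobenius_eval (mwiden f) = f.@[v] ^+ 2.
Proof.
elim/mpolyind: f => [|c mm f _ _ IHf].
  by rewrite mwiden0 rmorph0 meval0 expr0n.
rewrite mwidenD rmorphD IHf mevalD sqrrD_char2 //; congr (_ + _).
rewrite mwidenZ -mul_mpolyC rmorphM /= frobenius_evalC mevalZ exprMn; congr (_ * _).
rewrite mpolyXE_id rmorph_prod [in LHS]rmorph_prod /= rmorph_prod /= -prodrXl.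
apply: eq_bigr => i _; rewrite !rmorphXn /= mevalXU -exprM mulnC exprM.
rewrite mwidenX mnmwiden1 /frobenius_eval /= mmapX mmap1U.
have -> : widen_ord (leqnSn m) i = lift ord_max i.
  by apply/val_inj; rewrite /= /bump leqNgt ltn_ord.
by rewrite liftK.
Qed.
End Evaluation.
End Specialization.

(** The relations are evaluated at the point [(v, sqrt u)] of the quadric. A remainder
    [alpha + beta * X_last] takes there a value with square [alpha(v)^2 + beta(v)^2 u]. The
    polynomial [P] keeps the minor from vanishing. *)
Lemma specialize_isotropy (F : fieldType) (char2 : 2%N \in [pchar F]) m n
    (a : 'I_m.+2 -> F) (b : 'I_n -> F) (Fp : fieldType) (iota : {rmorphism F -> Fp})
    (i := isotropy_index (map_mpoly iota (diag_form b))) :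
  (forall v : 'I_m.+2 -> F, \sum_k a k * v k ^+ 2 = 0 -> forall k, v k = 0) ->
  is_function_field (diag_form a) iota ->
  exists2 P : {mpoly F[m.+1]}, P != 0 & forall v, P.@[v] != 0 -> (exists k, v k != 0) /\
    let u := \sum_k a (widen_ord (leqnSn _) k) / a ord_max * v k ^+ 2 in
    exists (c d : 'M[F]_(i, n)) (sigma : 'I_i -> 'I_n),
      \det (\matrix_(r, l) (c r (sigma l) ^+ 2 + d r (sigma l) ^+ 2 * u)) != 0 /\
      forall r, \sum_l b l * (c r l ^+ 2 + d r l ^+ 2 * u) = 0.
Proof.
move=> a_an /(isotropy_relations char2 b)[f [sigma [detP relP]]].
have aNZ := anisotropic_coef_neq0 a_an ord_max.
have [al [be [g0 detE]]] := mod_diag_form (\det (colsub sigma f)) aNZ.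
pose P0 := if al == 0 then be else al.
have P0NZ : P0 != 0.
  rewrite /P0; have [al0|//] := eqVneq al 0; apply/eqP => be0; apply: detP; exists g0.
  by rewrite detE al0 be0 mwiden0 mul0r !add0r.
(* The factor ['X_ord0] forces [v] to be nonzero. *)
exists (P0 * 'X_ord0) => [|v].
  rewrite mulf_neq0 //; apply/eqP => /(congr1 (meval (fun=> 1 : F))).
  by rewrite mevalXU meval0 => /eqP; rewrite oner_eq0.
rewrite mevalM mevalXU mulf_eq0 negb_or => /andP[Pv v0]; split; first by exists ord0.
set u := \sum_k _; cbv zeta.
have au : a ord_max * u = \sum_k a (widen_ord (leqnSn _) k) * v k ^+ 2.
  by rewrite mulr_sumr; apply: eq_bigr => k _; rewrite mulrA [_ * (_ / _)]mulrC divfK.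
pose ev := frobenius_eval char2 v u.
have evp : ev (diag_form a) = 0.
  rewrite diag_form_recr rmorphD rmorphM rmorphM /= /ev.
  rewrite frobenius_eval_widen frobenius_evalC frobenius_eval_last.
  have -> : (diag_form (fun i0 => a (widen_ord (leqnSn m.+1) i0))).@[v] = a ord_max * u.
    rewrite au raddf_sum /=; apply: eq_bigr => k _.
    by rewrite mevalZ rmorphXn /= mevalXU.
  by rewrite -expr2 -exprMn addrr_pchar2.
have evE h x y g : h = mwiden x + mwiden y * 'X_ord_max + g * diag_form a ->
    ev h = x.@[v] ^+ 2 + y.@[v] ^+ 2 * u.
  move=> ->; rewrite rmorphD rmorphM evp mulr0 addr0 rmorphD rmorphM /ev.
  by rewrite !frobenius_eval_widen frobenius_eval_last.
have evdet : ev (\det (colsub sigma f)) != 0.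
  rewrite (evE _ _ _ _ detE); apply/eqP => ev0.
  (* If the minor vanished at the point, this vector would be a zero of the anisotropic form; then
     [al] and [be] both vanish at [v], against the choice of [P0]. *)
  pose w k : F := if unlift ord_max k is Some l then be.@[v] * v l else al.@[v].
  have w0 : \sum_k a k * w k ^+ 2 = 0.
    rewrite big_ord_recr /= /w unlift_none.
    transitivity (be.@[v] ^+ 2 * (a ord_max * u) + a ord_max * al.@[v] ^+ 2).
      congr (_ + _); rewrite au mulr_sumr; apply: eq_bigr => k _.
      have {2}-> : widen_ord (leqnSn m.+1) k = lift ord_max k.
        by apply/val_inj; rewrite /= /bump leqNgt ltn_ord.
      by rewrite liftK exprMn; ring.
    by rewrite mulrCA -mulrDr addrC ev0 mulr0.
  have := a_an _ w0 ord_max; rewrite /w unlift_none => al0.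
  have := a_an _ w0 (lift ord_max ord0); rewrite /w liftK => /eqP.
  rewrite mulf_eq0 (negPf v0) orbF => /eqP be0.
  by move: Pv; rewrite /P0; case: ifP => _; rewrite ?al0 ?be0 eqxx.
have [cd cdE] := choice (fun rl : 'I_i * 'I_n =>
  let: ex_intro x (ex_intro y h) := mod_diag_form (f rl.1 rl.2) aNZ in
  ex_intro (fun xy => exists g, f rl.1 rl.2 =
     mwiden xy.1 + mwiden xy.2 * 'X_ord_max + g * diag_form a) (x, y) h).
have evf r l : ev (f r l) = (cd (r, l)).1.@[v] ^+ 2 + (cd (r, l)).2.@[v] ^+ 2 * u.
  by have [g /evE] := cdE (r, l).
exists (\matrix_(r, l) (cd (r, l)).1.@[v]), (\matrix_(r, l) (cd (r, l)).2.@[v]), sigma.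
split=> [|r].
  rewrite -det_map_mx in evdet; move: evdet; congr (is_true (\det _ != 0)).
  by apply/matrixP => r l; rewrite !mxE evf.
have [g /(congr1 ev)] := relP r; rewrite rmorphM evp mulr0 rmorph_sum /= => h.
(* Since [ev] squares the scalars [b l], it produces the square of the wanted sum. *)
apply: (sqr_inj_char2 char2); rewrite expr0n -[RHS]h sum_sqr_char2 //.
apply: eq_bigr => l _; rewrite rmorphM rmorphXn evf !mxE exprMn.
by rewrite /ev frobenius_evalC.
Qed.

(** Let [E = B(u)], of degree at most 2. The invertible minor expresses [i] of the [b l] through the
    other [n - i] over [E], and [V + V u] lies in the [E]-space that these span. *)
Lemma dim_sum_line_le (B : fieldType) (L : fieldExtType B) n i (b : 'I_n -> L) (u : L)
    (A : 'M[L]_(i, n)) (sigma : 'I_i -> 'I_n) (V := <<[seq b l | l : 'I_n]>>%VS) :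
  u ^+ 2 \in 1%VS -> (forall r l, A r l \in <<1; u>>%VS) ->
  \det (colsub sigma A) != 0 -> (forall r, \sum_l b l * A r l = 0) ->
  (\dim (V + V * <[u]>)%VS <= 2 * (n - i))%N.
Proof.
move=> u2 AE detA relA; pose E : {subfield L} := <<1; u>>%AS.
have uE : u \in E by apply: memv_adjoin.
have dimE : (\dim E <= 2)%N.
  have -> : \dim E = (adjoin_degree 1%AS u * \dim (1%AS : {subfield L}))%N := dim_Fadjoin _ _.
  rewrite dimv1 muln1.
  have [u1|u1] := boolP (u \in (1%AS : {subfield L})).
    by have := adjoin_deg_eq1 1%AS u; rewrite u1 => /eqP ->.
  by rewrite adjoin_degree_sqrt.
pose AS : 'M[subvs_of E]_(i, n) := \matrix_(r, l) Subvs (AE r l).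
have ASE : map_mx vsval AS = A by apply/matrixP => r l; rewrite !mxE.
pose Asg := colsub sigma AS.
have Asg_unit : Asg \in unitmx.
  rewrite unitmxE unitfE; apply: contraNneq detA => det0.
  have -> : colsub sigma A = map_mx vsval Asg by apply/matrixP => r l; rewrite !mxE.
  by rewrite det_map_mx det0 rmorph0.
(* Row reduction: the columns of [D] selected by [sigma] form the identity matrix, so [sigma] is
   injective. *)
pose D := invmx Asg *m AS.
have Dsg r r' : D r (sigma r') = (r == r')%:R.
  transitivity ((invmx Asg *m Asg) r r'); last by rewrite mulVmx // mxE.
  by rewrite [LHS]mxE [RHS]mxE; apply: eq_bigr => k _; rewrite [in RHS]mxE.
have relD r : \sum_l b l * vsval (D r l) = 0.
  have h l : b l * vsval (D r l) = \sum_k vsval (invmx Asg r k) * (b l * A k l).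
    rewrite mxE rmorph_sum mulr_sumr; apply: eq_bigr => k _.
    by rewrite rmorphM /= mulrCA -ASE !mxE.
  rewrite (eq_bigr _ (fun l _ => h l)) exchange_big big1 // => k _.
  by rewrite -mulr_sumr relA mulr0.
have sigma_inj : injective sigma.
  move=> r r' rr'; have := Dsg r r'; rewrite -rr' Dsg eqxx.
  by case: eqP => // _ /eqP; rewrite oner_eq0.
pose S : {set 'I_n} := [set sigma r | r : 'I_i].
pose T := <<[seq b l | l in ~: S]>>%VS.
have dimT : (\dim T <= n - i)%N.
  rewrite (leq_trans (dim_span _)) // size_image cardsCs finset.setCK.
  by rewrite card_ord card_imset // card_ord.
have bT l : l \notin S -> b l \in T.
  by move=> lS; apply: memv_span; apply/mapP; exists l; rewrite ?mem_enum ?finset.in_setC.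
have ET e x : e \in E -> x \in T -> e * x \in (E * T)%VS by apply: memv_mul.
have VET : (V <= E * T)%VS.
  apply/span_subvP => _ /mapP[l _ ->].
  have [lS|/bT lT] := boolP (l \in S); last by rewrite -[b l]mul1r ET ?mem1v.
  case/imsetP: lS => r _ ->.
  have := relD r; rewrite (bigD1 (sigma r)) //= Dsg eqxx rmorph1 mulr1 => /eqP.
  rewrite addr_eq0 => /eqP ->; rewrite rpredN; apply: rpred_sum => k kr.
  have [/imsetP[r' _ kE]|/bT kT] := boolP (k \in S); last by rewrite mulrC ET // subvsP.
  rewrite kE Dsg; case: eqP => [rr'|_]; first by rewrite kE rr' eqxx in kr.
  by rewrite rmorph0 mulr0 mem0v.
rewrite (leq_trans (_ : _ <= \dim (E * T)%VS)%N) //; last first.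
  by rewrite (leq_trans (dim_prodv _ _)) // leq_mul.
apply: dimvS; rewrite subv_add VET /= (subv_trans (prodvSl _ VET)) // prodvC prodvA.
by rewrite prodvSl // prodv_sub // -memvE.
Qed.

(** * The norm degree as the dimension of a subfield *)

Section NormDegree.
Variables (F : fieldType) (char2 : 2%N \in [pchar F]).
Variables (L : fieldExtType F) (j : {rmorphism L -> F}).
Hypothesis jA : forall c, j c%:A = c ^+ 2.
Local Open Scope classical_set_scope.

(** Each [x ^+ 2] is the scalar [j x], since both have the same image under [j]. *)
Lemma sqr_scalar (x : L) : x ^+ 2 \in 1%VS.
Proof.
apply/vlineP; exists (j x); apply: (fmorph_inj j).
by rewrite jA rmorphXn.
Qed.

Lemma j_scale c x : j (c *: x) = c ^+ 2 * j x.
Proof. by rewrite -jA -rmorphM /= -scalerAl mul1r. Qed.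

Lemma j_comb (I : Type) (r : seq I) (P : pred I) (c : I -> F) (x : I -> L) :
  j (\sum_(i <- r | P i) c i *: x i) = \sum_(i <- r | P i) c i ^+ 2 * j (x i).
Proof. by rewrite rmorph_sum; apply: eq_bigr => i _; rewrite /= j_scale. Qed.

Lemma squares_choice (I : Type) (c : I -> F) :
  (forall i, squares (c i)) -> exists k, forall i, c i = k i ^+ 2.
Proof.
move=> cS; have cS' i : exists k, c i = k ^+ 2 by have [k _ <-] := cS i; exists k.
by have [k kP] := choice cS'; exists k.
Qed.

Definition image_set (N : {vspace L}) : set F := [set y | exists2 x, x \in N & y = j x].

(** Under [j] a scalar [c] becomes the square [c ^+ 2], so bases of [N] over [F] correspond to bases
    of its image over [F^2]; this also shows that only one degree is possible. *)
Lemma ext_degree_image (N : {vspace L}) : ext_degree (@squares F) (image_set N) = \dim N.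
Proof.
rewrite /ext_degree; set S := (S in xget _ S).
have Sdim : S (\dim N).
  exists (fun i => j (vbasis N)`_i); split=> [i|_ [x xN ->]].
    by exists (vbasis N)`_i => //; rewrite vbasis_mem // mem_nth ?size_tuple.
  exists [ffun i => coord (vbasis N) i x ^+ 2]; split.
    split=> [i|]; first by rewrite ffunE; exists (coord (vbasis N) i x).
    rewrite {1}(coord_vbasis xN) j_comb; apply: eq_bigr => i _.
    by rewrite ffunE.
  move=> c [cS xE]; apply/ffunP => i; rewrite ffunE.
  have [d dE] := squares_choice cS.
  have xd : x = \sum_(i < \dim N) d i *: (vbasis N)`_i.
    apply: (fmorph_inj j); rewrite j_comb xE; apply: eq_bigr => k _.
    by rewrite dE.
  rewrite dE; congr (_ ^+ 2).
  by rewrite xd coord_sum_free // (basis_free (vbasisP N)).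
have [b [bN bE]] := xgetPex 0%N (ex_intro S _ Sdim).
set d := xget 0%N S in b bN bE *.
have [e /all_and2[eN eE]] := choice (fun i => let: ex_intro2 x h1 h2 := bN i in
  ex_intro (fun x => x \in N /\ b i = j x) x (conj h1 h2)).
pose X := [tuple e i | i < d].
have XE (i : 'I_d) : X`_i = e i by rewrite -tnth_nth tnth_mktuple.
have X_basis : basis_of N X.
  rewrite /basis_of eqEsubv -andbA; apply/and3P; split.
  - by apply/span_subvP => _ /mapP[i _ ->].
  - apply/subvP => x xN; have [|c [[cS xE] _]] := bE (j x); first by exists x.
    have [k kE] := squares_choice cS.
    have -> : x = \sum_(i < d) k i *: e i.
      apply: (fmorph_inj j); rewrite j_comb xE; apply: eq_bigr => i _.
      by rewrite kE eE.
    apply: rpred_sum => i _; apply: rpredZ; apply: memv_span.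
    by rewrite -XE mem_nth // size_tuple.
  - apply/freeP => k k0 i.
    have N0 : image_set N 0 by exists 0; rewrite ?mem0v ?rmorph0.
    have [c [[_ c0] cu]] := bE 0 N0.
    have h1 : c = [ffun i => k i ^+ 2].
      apply: cu; split=> [l|]; first by rewrite ffunE; exists (k l).
      transitivity (j (\sum_(l < d) k l *: X`_l)); first by rewrite k0 rmorph0.
      rewrite j_comb; apply: eq_bigr => l _.
      by rewrite ffunE XE eE.
    have h2 : c = [ffun i => 0].
      apply: cu; split=> [l|]; first by rewrite ffunE; exists 0; rewrite ?expr0n.
      by rewrite big1 // => l _; rewrite ffunE mul0r.
    by move: h1; rewrite h2 => /ffunP/(_ i); rewrite !ffunE => /esym/eqP; rewrite sqrf_eq0 => /eqP.
by case/andP: X_basis => /eqP <- /eqnP ->; rewrite size_tuple.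
Qed.

(** The values of the form are [a ord_max] times the image of [U], so their products lie in the
    image of the algebra generated by [U]. Conversely, a subfield [K] containing these products
    contains all squares and all [a k / a ord_max]; its preimage [T] contains 1 and is stable under
    [U]. *)
Lemma norm_field_diag_form m (a : 'I_m.+1 -> F) (aL : 'I_m.+1 -> L) :
  a ord_max != 0 -> (forall k, j (aL k) = a k / a ord_max) ->
  norm_field (diag_form a) = image_set (agenv <<[seq aL k | k : 'I_m.+1]>>).
Proof.
move=> aNZ aLE; set U := <<_>>%VS.
have aU k : aL k \in U by apply: memv_span; apply/mapP; exists k; rewrite ?mem_enum.
have valE v : qval (diag_form a) v = a ord_max * j (\sum_k v ord0 k *: aL k).
  rewrite qval_diag_form j_comb mulr_sumr; apply: eq_bigr => k _.
  by rewrite aLE; field.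
have valU v : \sum_k v ord0 k *: aL k \in U by apply: rpred_sum => k _; apply: rpredZ.
rewrite /norm_field; apply/seteqP; split.
  apply: smallest_sub.
    split=> [|_ _ [x xN ->] [y yN ->]|_ _ [x xN ->] [y yN ->]].
    - by exists 1; rewrite ?rmorph1 // (subvP (sub1_agenv U)) // memv_line.
    - by exists (x - y); rewrite ?rmorphB // rpredB.
    - exists (x / y); rewrite ?fmorph_div //.
      have /(_ x y^-1) := @memvM _ _ (agenv_aspace U); apply=> //.
      by rewrite memvV.
  move=> _ [_ [v _ <-]] [_ [w _ <-]] <-; rewrite !valE.
  set x := \sum_k _; set y := \sum_k _.
  exists (a ord_max *: (x * y)); last by rewrite j_scale rmorphM /=; ring.
  apply: rpredZ; have /(_ x y) := @memvM _ _ (agenv_aspace U).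
  by apply; apply: (subvP (sub_agenv U)); apply: valU.
move=> _ [x xN ->]; move=> K [[K1 KB KV] Kab].
have K0 : K 0 by rewrite -(subrr 1); apply: KB.
have KN y : K y -> K (- y) by move=> Ky; rewrite -[- y]add0r; apply: KB.
have KD y z : K y -> K z -> K (y + z).
  by move=> Ky Kz; rewrite -[z]opprK; apply: KB => //; apply: KN.
have KM y z : K y -> K z -> K (y * z).
  by move=> Ky Kz; rewrite -[z]invrK; apply: (KV) => //; rewrite -[_^-1]mul1r; apply: KV.
have Kdiv k c : K (c ^+ 2 * (a k / a ord_max)).
  have Kprod l e : K (a l * e ^+ 2 * a ord_max).
    have val l' e' : values (diag_form a) (a l' * e' ^+ 2).
      exists (\row_k' if k' == l' then e' else 0) => //.
      rewrite qval_diag_form (bigD1 l') //= mxE eqxx big1 ?addr0 // => i /negPf il.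
      by rewrite mxE il expr0n mulr0.
    apply: Kab; exists (a l * e ^+ 2) => //; exists (a ord_max) => //.
    by have := val ord_max 1; rewrite expr1n mulr1.
  have -> : c ^+ 2 * (a k / a ord_max) =
      (a k * c ^+ 2 * a ord_max) / (a ord_max * 1 ^+ 2 * a ord_max).
    by rewrite expr1n mulr1; field.
  exact: KV.
have Ksq c : K (c ^+ 2) by have := Kdiv ord_max c; rewrite divff ?mulr1.
have [||T TE] := exists_vspace (S := fun y : L => K (j y)).
- by rewrite rmorph0.
- by move=> c y z Ky Kz; rewrite rmorphD /= j_scale; apply: KD => //; apply: KM.
apply/TE; apply: (subvP _ _ xN); apply: agenv_sub_modl.
  by rewrite -memvE; apply/TE; rewrite rmorph1.
apply/prodvP => y z yU zT; apply/TE; rewrite rmorphM; apply: KM; last exact/TE.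
apply/TE; apply: (subvP _ _ yU); apply/span_subvP => _ /mapP[k _ ->].
by apply/TE; rewrite aLE; have := Kdiv k 1; rewrite expr1n mul1r.
Qed.
End NormDegree.

(** * From the isotropy index to the decomposition of [\dim q] *)

Section Assembly.
Variables (F : fieldType) (char2 : 2%N \in [pchar F]).

(** With [k = n - 2 * i], the last hypothesis reads [2 * k <= 2 ^ s], and the two final bounds say
    that the multiple lies between [n - k] and [n + k], without subtraction. *)
Lemma multiple_near_dim m n (a : 'I_m.+2 -> F) (b : 'I_n -> F)
    (Fp : fieldType) (iota : {rmorphism F -> Fp}) s
    (i := isotropy_index (map_mpoly iota (diag_form b))) :
  (forall v : 'I_m.+2 -> F, \sum_k a k * v k ^+ 2 = 0 -> forall k, v k = 0) ->
  (forall v : 'I_n -> F, \sum_k b k * v k ^+ 2 = 0 -> forall k, v k = 0) ->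
  is_function_field (diag_form a) iota ->
  (2 ^ s < m.+2)%N -> (2 * n <= 4 * i + 2 ^ s)%N ->
  exists c, [/\ (s < lndeg (diag_form a))%N, (2 * i <= c * 2 ^ lndeg (diag_form a))%N
    & (c * 2 ^ lndeg (diag_form a) + 2 * i <= 2 * n)%N].
Proof.
move=> a_an b_an a_ff m_gt n_le.
have aNZ := anisotropic_coef_neq0 a_an ord_max.
have i_le : (i <= n)%N by rewrite (leq_trans (dimvS (subvf _))) // dimvf /dim /= mul1n.
have infF : forall p : {poly F}, p != 0 -> exists x, p.[x] != 0.
  exact: (anisotropic_infinite char2 a_an (i1 := ord0) (i2 := ord_max)).
have [P PNZ hP] := specialize_isotropy char2 b a_an a_ff; rewrite -/i in hP.
have [L [j [jA j_im]]] := exists_sqr_ext char2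
  ([seq a k / a ord_max | k : 'I_m.+2] ++ [seq b l | l : 'I_n]).
have [aL aLE] : exists aL, forall k, j (aL k) = a k / a ord_max.
  have h k : exists x, j x = a k / a ord_max.
    by apply: j_im; rewrite mem_cat; apply/orP; left; apply/mapP; exists k; rewrite ?mem_enum.
  by have [aL] := choice h; exists aL.
have [bL bLE] : exists bL, forall l, j (bL l) = b l.
  have h l : exists x, j x = b l.
    by apply: j_im; rewrite mem_cat; apply/orP; right; apply/mapP; exists l; rewrite ?mem_enum.
  by have [bL] := choice h; exists bL.
have sq := sqr_scalar jA.
pose U := <<[seq aL k | k : 'I_m.+2]>>%VS; pose V := <<[seq bL l | l : 'I_n]>>%VS.
have dimspan d (x : 'I_d -> L) : (forall k : 'I_d -> F, \sum_l k l *: x l = 0 -> forall l, k l = 0) ->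
    \dim <<[seq x l | l : 'I_d]>>%VS = d.
  move=> x_free; have xE : [seq x l | l : 'I_d] = [tuple x l | l < d] by [].
  have : free [tuple x l | l < d].
    apply/freeP => k k0; apply: x_free; rewrite -[RHS]k0; apply: eq_bigr => l _.
    by rewrite -tnth_nth tnth_mktuple.
  by rewrite xE => /eqnP ->; rewrite size_tuple.
have dimU : \dim U = m.+2.
  apply: dimspan => k /(congr1 j); rewrite rmorph0 (j_comb jA) => k0; apply: a_an.
  rewrite -[RHS](mulr0 (a ord_max)) -[in RHS]k0 mulr_sumr; apply: eq_bigr => l _.
  by rewrite aLE; field.
have dimV : \dim V = n.
  apply: dimspan => k /(congr1 j); rewrite rmorph0 (j_comb jA) => k0; apply: b_an.
  by rewrite -[RHS]k0; apply: eq_bigr => l _; rewrite bLE mulrC.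
have aU k : aL k \in U by apply: memv_span; apply/mapP; exists k; rewrite ?mem_enum.
have aL1 : aL ord_max = 1 by apply: (fmorph_inj j); rewrite aLE divff // rmorph1.
have U1 : 1 \in U by rewrite -aL1.
(* The generic [u] combines all generators of [U] but the last, which is 1. The inclusions for these
   extend to [U] in [genU], as multiplication by 1 is harmless. *)
pose w k := aL (widen_ord (leqnSn _) k).
have jcomb v : j (lincomb w v) = \sum_k a (widen_ord (leqnSn _) k) / a ord_max * v k ^+ 2.
  by rewrite /lincomb (j_comb jA); apply: eq_bigr => k _; rewrite aLE mulrC.
have combU v : lincomb w v \in U by apply: rpred_sum => k _; apply/rpredZ/aU.
have combNZ v : P.@[v] != 0 -> lincomb w v != 0.
  case/hP => -[k /eqP vk] _; apply/eqP => /(congr1 j); rewrite rmorph0 jcomb => v0.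
  apply: vk; pose v' k := if unlift ord_max k is Some l then v l else 0.
  have -> : v k = v' (lift ord_max k) by rewrite /v' liftK.
  apply: a_an; rewrite big_ord_recr /= /v' unlift_none expr0n mulr0 addr0.
  rewrite -[RHS](mulr0 (a ord_max)) -[in RHS]v0 mulr_sumr; apply: eq_bigr => l _.
  have -> : widen_ord (leqnSn m.+1) l = lift ord_max l.
    by apply/val_inj; rewrite /= /bump leqNgt ltn_ord.
  by rewrite liftK; field.
have [v [Pv v_gen]] := exists_generic_lincomb infF sq U V PNZ combNZ.
set u := lincomb w v in v_gen.
have uNZ : u != 0 := combNZ _ Pv.
have genU X : (forall v' : 'I_m.+1 -> F,
    ((X :&: X * <[u]>) * <[lincomb w v']> <= X + X * <[u]>)%VS) ->
    (U * (X :&: X * <[u]>) <= X + X * <[u]>)%VS.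
  move=> hX; rewrite prodvC; apply/prodvP => z y zX yU.
  have [k ->] : exists k : 'I_m.+2 -> F, y = \sum_l k l *: aL l.
    have -> := coord_span (X := [tuple aL l | l < m.+2]) yU.
    exists (fun l => coord [tuple aL l | l < m.+2] l y); apply: eq_bigr => l _.
    by rewrite -tnth_nth tnth_mktuple.
  rewrite big_ord_recr /= aL1 mulrDr rpredD //.
    by rewrite (subvP (hX (fun l => k (widen_ord (leqnSn _) l)))) // memv_mul ?memv_line.
  rewrite -scalerAr mulr1 rpredZ // (subvP (addvSl _ _)) //.
  by move: zX; rewrite memv_cap => /andP[].
have dimW : (\dim (V + V * <[u]>)%VS <= 2 * (n - i))%N.
  have [_ [c [d [sigma [det_cd rel_cd]]]]] := hP _ Pv.
  rewrite -jcomb -/u in det_cd rel_cd.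
  (* The entry [c + d * u] is chosen so that [j] maps it to the specialized value
     [c ^+ 2 + d ^+ 2 * j u]. *)
  pose A := \matrix_(r < i, l < n) ((c r l)%:A + d r l *: u).
  have jAE r l : j (A r l) = c r l ^+ 2 + d r l ^+ 2 * j u.
    by rewrite mxE rmorphD /= jA (j_scale jA).
  apply: (@dim_sum_line_le _ _ _ _ bL u A sigma) => // [r l||r].
  - rewrite mxE rpredD ?rpredZ ?memv_adjoin //.
    by rewrite (subvP (subv_adjoin _ _)) // memv_line.
  - apply: contraNneq det_cd => /(congr1 j); rewrite rmorph0 -det_map_mx => <-.
    by apply/eqP; congr (\det _); apply/matrixP => r l; rewrite !mxE rmorphD /= jA (j_scale jA).
  - apply: (fmorph_inj j); rewrite rmorph0 rmorph_sum -[RHS](rel_cd r).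
    by apply: eq_bigr => l _; rewrite rmorphM /= bLE jAE.
have dimWV := dim_cap_sum_line V uNZ.
have [c] : exists c, (\dim (V :&: V * <[u]>)%VS <= c * \dim (agenv U) <= \dim (V + V * <[u]>)%VS)%N.
  apply: (near_multiple sq U1 uNZ (combU v) (s := s)).
  - by rewrite dimU.
  - by apply: genU => v'; case: (v_gen v').
  - by apply: genU => v'; case: (v_gen v').
  have arith W D e : (W <= 2 * (n - i) -> W + D = 2 * e -> D <= e -> e = n ->
      2 * (W - e) <= 2 ^ s)%N by move: n_le; clear; lia.
  by apply: arith dimW dimWV _ dimV; rewrite dimvS ?capvSl.
have [r rE] := dim_subfield_pow2 (agenv_aspace U) sq.
have lnE : lndeg (diag_form a) = r.
  by rewrite /lndeg (norm_field_diag_form jA aNZ aLE) (ext_degree_image jA) rE trunc_expnK.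
have -> : \dim (agenv U) = (2 ^ r)%N := rE.
rewrite lnE dimV in dimWV * => /andP[Zc cW]; exists c; split.
- rewrite -(@ltn_exp2l 2) // -rE (leq_trans m_gt) // -dimU.
  by apply/dimvS/sub_agenv.
- have arith W D e : (W <= 2 * (n - i) -> W + D = 2 * n -> D <= e -> 2 * i <= e)%N.
    by move: i_le; clear; lia.
  exact: arith dimW dimWV Zc.
- have arith W e : (W <= 2 * (n - i) -> e <= W -> e + 2 * i <= 2 * n)%N.
    by move: i_le; clear; lia.
  exact: arith dimW cW.
Qed.
End Assembly.

Theorem theorem5p7 (F : fieldType) (char2F : 2%N \in [pchar F])
    (m n : nat) (p : {mpoly F[m]}) (q : {mpoly F[n]})
    (p_ql : quasilinear p) (q_ql : quasilinear q)
    (p_an : anisotropic p) (q_an : anisotropic q)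
    (m_ge2 : (2 <= m)%N) (n_ge2 : (2 <= n)%N)
    (Fp : fieldType) (iota : {rmorphism F -> Fp})
    (Fp_function_field : is_function_field p iota)
    (s : nat) (s_def : (2 ^ s < m <= 2 ^ s.+1)%N)
    (k : int)
    (k_def : k = n%:Z - 2%:Z * (isotropy_index (map_mpoly iota q))%:Z)
    (k_le : k%:~R <= (2%:R : rat) ^ (s%:Z - 1)) :
  (exists (a : nat) (eps : int),
      n%:Z = a%:Z * 2%:Z ^+ lndeg p + eps /\ - k <= eps <= k) /\
  (exists (a' : nat) (eps' : int),
      n%:Z = a'%:Z * 2%:Z ^+ s.+1 + eps' /\ - k <= eps' <= k).
Proof.
case: m m_ge2 p s_def p_ql p_an Fp_function_field => [|[|m]] // _ p /andP[m_gt _] p_ql p_an p_ff.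
have [a aE] := quasilinear_qval char2F p_ql.
have [b bE] := quasilinear_qval char2F q_ql.
have a_an := anisotropic_diag_form char2F aE p_an.
have b_an := anisotropic_diag_form char2F bE q_an.
have infF : forall f : {poly F}, f != 0 -> exists x, f.[x] != 0.
  exact: (anisotropic_infinite char2F a_an (i1 := ord0) (i2 := ord_max)).
rewrite (quasilinear_diag_form infF aE) in p_ff *.
rewrite (quasilinear_diag_form infF bE) in k_def.
set i := isotropy_index _ in k_def.
have powZ e : (2 ^ e)%N%:Z = 2%:Z ^+ e by rewrite -[LHS]natz natrX.
have n_le : (2 * n <= 4 * i + 2 ^ s)%N.
  (* The exponent [s - 1] can be -1, so the given bound is rational; doubling makes it an inequality
     of integers. *)
  have : (k * 2)%:~R <= (2 ^+ s)%:~R :> rat.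
    rewrite rmorphM rmorphXn /= (le_trans (ler_wpM2r _ k_le)) //.
    by rewrite expfzDr // exprN1 divfK.
  rewrite ler_int k_def => h.
  have : (n%:Z - 2%:Z * i%:Z) * 2 <= (2 ^ s)%N%:Z by rewrite powZ.
  clear; lia.
have [c [sr ic ci]] := multiple_near_dim char2F a_an b_an p_ff m_gt n_le.
set r := lndeg _ in sr ic ci *.
have near (e : nat) : e = (c * 2 ^ r)%N -> exists eps : int,
    n%:Z = e%:Z + eps /\ - k <= eps <= k.
  move=> eE; rewrite -eE in ic ci; exists (n%:Z - e%:Z); split; first by ring.
  by rewrite k_def; move: ic ci; rewrite -/i; clear; lia.
split.
  have [eps [nE epsk]] := near _ erefl; exists c, eps; split=> //.
  by rewrite nE PoszM powZ.
(* As [s < r], the same multiple of [2 ^ r] is also one of [2 ^ s.+1]. *)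
have [|eps [nE epsk]] := near (c * 2 ^ (r - s.+1) * 2 ^ s.+1)%N.
  by rewrite -mulnA -expnD subnK.
exists (c * 2 ^ (r - s.+1))%N, eps; split=> //.
by rewrite nE PoszM powZ.
Qed.
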